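(* Let $\Bbbk$ be an algebraically closed field and $n\geq 2$. There are no full exceptional sequences of $C_n$-modules.
   Context: Modules are finite-dimensional right modules. The algebra $C_n$ ($n\geq 2$): consider the quiver with vertices $1,2,\dots,n$ and, for each $1\leq i\leq n-1$, one arrow $i\to i+1$ and one arrow $i+1\to i$. Then $C_n$ is the quotient of the path algebra over $\Bbbk$ of this quiver by the ideal generated by the relations: any path of length three is zero; any path of length two which is not a cycle is zero; for each vertex $v$, all length two cycles which start and terminate at $v$ are equal; the length two cycle at the vertex $n$ is zero; the length two cycle at the vertex $1$ is zero. Let $\Lambda$ be a finite-dimensional $\Bbbk$-algebra. A $\Lambda$-module $M$ is exceptional if $\mathrm{Hom}_\Lambda(M,M)=\Bbbk$ and $\mathrm{Ext}^i_\Lambda(M,M)=0$ for all $i>0$. A sequence $(M_1,\dots,M_k)$ of $\Lambda$-modules is an exceptional sequence if each $M_i$ is exceptional and $\mathrm{Ext}^i_\Lambda(M_t,M_s)=0$ for all $1\leq s<t\leq k$ and all $i\geq 0$. An exceptional sequence is full if it generates the (bounded) derived category of $\Lambda$-modules (as a triangulated category). *)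

(* Defs.v *)
From HB Require Import structures.
From mathcomp Require Import all_boot all_algebra.
From mathcomp Require Import boolp.
From mathcomp Require Import finmap monalg.
From mathcomp Require Import zify.

Set Implicit Arguments.
Unset Strict Implicit.
Unset Printing Implicit Defensive.

Import GRing.Theory.
Local Open Scope ring_scope.
Local Open Scope quotient_scope.

(* Nonemptiness ensures 1 != 0 in the path algebra, as algType demands.      *)
Record quiver := Quiver {
  vertex : finType;
  arrow : finType;
  src : arrow -> vertex;
  tgt : arrow -> vertex;
  vertex_nonempty : (0 < #|{: vertex}|)%N }.

Section Paths.
Variable Q : quiver.

Fixpoint walk (v : vertex Q) (s : seq (arrow Q)) : bool :=
  if s is a :: s' then (src a == v) && walk (tgt a) s' else true.

(* A starting vertex and a composable word of arrows; the empty word at v is *)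
(* the trivial path at v.                                                    *)
Record qpath := QPath {
  pword : vertex Q * seq (arrow Q);
  pwordP : walk pword.1 pword.2 }.

HB.instance Definition _ := [isSub for pword].
HB.instance Definition _ := [Choice of qpath by <:].

Definition psrc (p : qpath) : vertex Q := (pword p).1.
Definition parrows (p : qpath) : seq (arrow Q) := (pword p).2.
Definition ptgt (p : qpath) : vertex Q := last (psrc p) (map (@tgt Q) (parrows p)).
Definition plength (p : qpath) : nat := size (parrows p).

Definition ptriv (v : vertex Q) : qpath := @QPath (v, [::]) isT.

Lemma walk_cat v s t :
  walk v (s ++ t) = walk v s && walk (last v (map (@tgt Q) s)) t.
Proof. by elim: s v => //= a s IH v; rewrite IH andbA. Qed.

Lemma qpath_eq p q : psrc p = psrc q -> parrows p = parrows q -> p = q.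
Proof.
move=> e1 e2; apply: val_inj => /=.
by rewrite [LHS]surjective_pairing [RHS]surjective_pairing; congr (_, _).
Qed.

Lemma pcat_subproof p q : ptgt p = psrc q ->
  walk (psrc p) (parrows p ++ parrows q).
Proof.
move=> e; rewrite walk_cat; apply/andP; split; first exact: (pwordP p).
by rewrite -/(ptgt p) e; exact: (pwordP q).
Qed.

Definition pcat p q (e : ptgt p = psrc q) : qpath :=
  @QPath (psrc p, parrows p ++ parrows q) (pcat_subproof e).

(* Paths compose from left to right: p q is p followed by q.                 *)
Definition pmul (p q : qpath) : option qpath :=
  if ptgt p =P psrc q is ReflectT e then Some (pcat e) else None.

Lemma pmulE p q (e : ptgt p = psrc q) : pmul p q = Some (pcat e).
Proof. by rewrite /pmul; case: eqP => // e'; congr Some; apply: qpath_eq. Qed.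

Lemma pmulN p q : ptgt p <> psrc q -> pmul p q = None.
Proof. by rewrite /pmul; case: eqP. Qed.

Lemma ptgt_cat p q (e : ptgt p = psrc q) : ptgt (pcat e) = ptgt q.
Proof. by rewrite {1}/ptgt /= map_cat last_cat -/(ptgt p) e. Qed.

Lemma pmulA p q r :
  obind (pmul p) (pmul q r) = obind (fun x => pmul x r) (pmul p q).
Proof.
case: (eqVneq (ptgt q) (psrc r)) => [e|/eqP ne].
  rewrite (pmulE e) /=; case: (eqVneq (ptgt p) (psrc q)) => [f|/eqP nf].
    have g : ptgt (pcat f) = psrc r by rewrite ptgt_cat.
    have h : ptgt p = psrc (pcat e) by rewrite f.
    by rewrite (pmulE f) /= (pmulE g) (pmulE h); congr Some; apply: qpath_eq;
      rewrite //= /parrows /= catA.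
  by rewrite (pmulN nf) /= pmulN.
rewrite (pmulN ne) /=; case: (eqVneq (ptgt p) (psrc q)) => [f|/eqP nf].
  by rewrite (pmulE f) /= pmulN // ptgt_cat.
by rewrite (pmulN nf).
Qed.

End Paths.

Definition path_algebra (k : fieldType) (Q : quiver) : Type := {malg k[qpath Q]}.
HB.instance Definition _ k Q := Choice.on (path_algebra k Q).

(* The operations are sealed copies of those of {malg k[qpath Q]}, which     *)
(* keeps unification from unfolding finitely supported functions.            *)
HB.lock Definition pa_zero (k : fieldType) (Q : quiver) : path_algebra k Q :=
  0 : {malg k[qpath Q]}.
HB.lock Definition pa_opp (k : fieldType) (Q : quiver)
  (f : path_algebra k Q) : path_algebra k Q := - (f : {malg k[qpath Q]}).
HB.lock Definition pa_add (k : fieldType) (Q : quiver)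
    (f g : path_algebra k Q) : path_algebra k Q :=
  (f : {malg k[qpath Q]}) + (g : {malg k[qpath Q]}).
HB.lock Definition pa_scale (k : fieldType) (Q : quiver)
    (c : k) (f : path_algebra k Q) : path_algebra k Q :=
  c *: (f : {malg k[qpath Q]}).

Section PathModule.
Variables (k : fieldType) (Q : quiver).
Local Notation path_algebra := (path_algebra k Q).

Lemma pa_addA : associative (@pa_add k Q).
Proof. by move=> f g h; rewrite pa_add.unlock addrA. Qed.
Lemma pa_addC : commutative (@pa_add k Q).
Proof. by move=> f g; rewrite pa_add.unlock addrC. Qed.
Lemma pa_add0 : left_id (@pa_zero k Q) (@pa_add k Q).
Proof. by move=> f; rewrite pa_add.unlock pa_zero.unlock add0r. Qed.
Lemma pa_addN : left_inverse (@pa_zero k Q) (@pa_opp k Q) (@pa_add k Q).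
Proof.
by move=> f; rewrite pa_add.unlock pa_zero.unlock pa_opp.unlock addNr.
Qed.
HB.instance Definition _ := GRing.isZmodule.Build path_algebra
  pa_addA pa_addC pa_add0 pa_addN.

Lemma pa_scaleA c d (f : path_algebra) :
  pa_scale c (pa_scale d f) = pa_scale (c * d) f.
Proof. by rewrite pa_scale.unlock scalerA. Qed.
Lemma pa_scale1 : left_id 1 (@pa_scale k Q).
Proof. by move=> f; rewrite pa_scale.unlock scale1r. Qed.
Lemma pa_scaleDr : right_distributive (@pa_scale k Q) +%R.
Proof.
move=> c f g; change (pa_scale c (pa_add f g) =
  pa_add (pa_scale c f) (pa_scale c g)).
by rewrite pa_scale.unlock pa_add.unlock scalerDr.
Qed.
Lemma pa_scaleDl (f : path_algebra) :
  {morph (@pa_scale k Q)^~ f : c d / c + d}.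
Proof.
move=> c d; change (pa_scale (c + d) f = pa_add (pa_scale c f) (pa_scale d f)).
by rewrite pa_scale.unlock pa_add.unlock scalerDl.
Qed.
HB.instance Definition _ := GRing.Zmodule_isLmodule.Build k path_algebra
  pa_scaleA pa_scale1 pa_scaleDr pa_scaleDl.

Lemma pa_coef0 p : (0 : path_algebra)@_p = 0.
Proof. by rewrite -[0]/(pa_zero k Q) pa_zero.unlock mcoeff0. Qed.

Lemma pa_coefD (f g : path_algebra) p : (f + g)@_p = f@_p + g@_p.
Proof. by rewrite -[f + g]/(pa_add f g) pa_add.unlock mcoeffD. Qed.

Lemma pa_coefZ c (f : path_algebra) p : (c *: f)@_p = c * f@_p.
Proof. by rewrite -[c *: f]/(pa_scale c f) pa_scale.unlock mcoeffZ. Qed.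

Lemma pa_coef_sum (I : Type) (r : seq I) (P : pred I) (F : I -> path_algebra) p :
  (\sum_(i <- r | P i) F i)@_p = \sum_(i <- r | P i) (F i)@_p.
Proof.
apply: (big_morph (fun f : path_algebra => f@_p)) => [f g|];
  [exact: pa_coefD|exact: pa_coef0].
Qed.

End PathModule.

HB.lock Definition pbasis (k : fieldType) (Q : quiver) (p : qpath Q) :
  path_algebra k Q := << p >>.

Definition pbmul (k : fieldType) (Q : quiver) (p q : qpath Q) :
  path_algebra k Q := oapp (@pbasis k Q) 0 (pmul p q).

HB.lock Definition pa_mul (k : fieldType) (Q : quiver) (f g : path_algebra k Q) :
    path_algebra k Q :=
  \sum_(p <- msupp f) \sum_(q <- msupp g) (f@_p * g@_q) *: pbmul k p q.

Section PathAlgebra.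
Variables (k : fieldType) (Q : quiver).
Local Notation path_algebra := (path_algebra k Q).
Local Notation pbasis := (@pbasis k Q).
Local Notation pbmul := (@pbmul k Q).
Local Notation pa_mul := (@pa_mul k Q).

Definition pa_one : path_algebra := \sum_(v : vertex Q) pbasis (ptriv v).

Lemma pa_coefb p q : (pbasis p)@_q = (p == q)%:R.
Proof. rewrite pbasis.unlock; exact: mcoeffU. Qed.

Lemma msupp_pbasis p : msupp (pbasis p) = [fset p]%fset.
Proof. by rewrite pbasis.unlock msuppU oner_eq0. Qed.

Lemma msupp_pa0 : msupp (0 : path_algebra) = fset0.
Proof. by rewrite -[0]/(pa_zero k Q) pa_zero.unlock msupp0. Qed.

Lemma msupp_paZ c (f : path_algebra) : (msupp (c *: f) `<=` msupp f)%fset.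
Proof.
by rewrite -[c *: f]/(pa_scale c f) pa_scale.unlock; exact: msuppZ_le.
Qed.

Lemma pa_sumE (f : path_algebra) : f = \sum_(p <- msupp f) f@_p *: pbasis p.
Proof.
apply/malgP => q; rewrite pa_coef_sum; under eq_bigr do
  rewrite pa_coefZ pa_coefb mulr_natr mulrb.
rewrite -big_mkcond /=; case: (msuppP f q) => [qf|nq].
  by rewrite (big_rem q) //= eqxx big1_seq ?addr0 // => p;
    rewrite mem_rem_uniq ?fset_uniq // !inE => /andP[/eqP->]; rewrite eqxx.
rewrite big1_seq // => p /andP[/eqP-> /=]; by rewrite (negbTE nq).
Qed.

Lemma pa_mulEw (d e : {fset qpath Q}) (f g : path_algebra) :
    (msupp f `<=` d)%fset -> (msupp g `<=` e)%fset ->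
  pa_mul f g = \sum_(p <- d) \sum_(q <- e) (f@_p * g@_q) *: pbmul p q.
Proof.
move=> fd ge; rewrite pa_mul.unlock; under eq_bigr => p _.
  rewrite (big_fset_incl _ ge) => [|q _ nq]; first over.
  by rewrite (mcoeff_outdom nq) mulr0 scale0r.
rewrite (big_fset_incl _ fd) // => p _ np.
by rewrite big1 // => q _; rewrite (mcoeff_outdom np) mul0r scale0r.
Qed.

Lemma pa_mulDl : left_distributive pa_mul +%R.
Proof.
move=> f g h; set d := (msupp f `|` msupp g `|` msupp (f + g))%fset.
have s1 : (msupp f `<=` d)%fset by rewrite /d -fsetUA fsubsetUl.
have s2 : (msupp g `<=` d)%fset by rewrite /d [(msupp f `|` _)%fset]fsetUC -fsetUA fsubsetUl.
have s3 : (msupp (f + g) `<=` d)%fset by rewrite /d fsubsetUr.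
have s4 := fsubset_refl (msupp h).
rewrite (pa_mulEw s3 s4) (pa_mulEw s1 s4) (pa_mulEw s2 s4) -big_split /=.
apply: eq_bigr => p _; rewrite -big_split /=; apply: eq_bigr => q _.
by rewrite pa_coefD mulrDl scalerDl.
Qed.

Lemma pa_mulDr : right_distributive pa_mul +%R.
Proof.
move=> h f g; set d := (msupp f `|` msupp g `|` msupp (f + g))%fset.
have s1 : (msupp f `<=` d)%fset by rewrite /d -fsetUA fsubsetUl.
have s2 : (msupp g `<=` d)%fset by rewrite /d [(msupp f `|` _)%fset]fsetUC -fsetUA fsubsetUl.
have s3 : (msupp (f + g) `<=` d)%fset by rewrite /d fsubsetUr.
have s4 := fsubset_refl (msupp h).
rewrite (pa_mulEw s4 s3) (pa_mulEw s4 s1) (pa_mulEw s4 s2) -big_split /=.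
apply: eq_bigr => p _; rewrite -big_split /=; apply: eq_bigr => q _.
by rewrite pa_coefD mulrDr scalerDl.
Qed.

Lemma pa_mulZl c f g : pa_mul (c *: f) g = c *: pa_mul f g.
Proof.
have s := fsubset_refl (msupp g).
rewrite (pa_mulEw (msupp_paZ c f) s) (pa_mulEw (fsubset_refl _) s).
rewrite scaler_sumr; apply: eq_bigr => p _; rewrite scaler_sumr.
by apply: eq_bigr => q _; rewrite pa_coefZ scalerA mulrA.
Qed.

Lemma pa_mulZr c f g : pa_mul f (c *: g) = c *: pa_mul f g.
Proof.
have s := fsubset_refl (msupp f).
rewrite (pa_mulEw s (msupp_paZ c g)) (pa_mulEw s (fsubset_refl _)).
rewrite scaler_sumr; apply: eq_bigr => p _; rewrite scaler_sumr.
by apply: eq_bigr => q _; rewrite pa_coefZ scalerA mulrCA.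
Qed.

Lemma pa_mul0l g : pa_mul 0 g = 0.
Proof. by rewrite pa_mul.unlock msupp_pa0 big_seq_fset0. Qed.

Lemma pa_mul0r g : pa_mul g 0 = 0.
Proof. by rewrite pa_mul.unlock big1 // => p _; rewrite msupp_pa0 big_seq_fset0. Qed.

Lemma pa_mul_suml (I : Type) (r : seq I) (P : pred I) F g :
  pa_mul (\sum_(i <- r | P i) F i) g = \sum_(i <- r | P i) pa_mul (F i) g.
Proof.
by apply: (big_morph (pa_mul^~ g)) => [x y|]; rewrite ?pa_mulDl ?pa_mul0l.
Qed.

Lemma pa_mul_sumr (I : Type) (r : seq I) (P : pred I) F g :
  pa_mul g (\sum_(i <- r | P i) F i) = \sum_(i <- r | P i) pa_mul g (F i).
Proof.
by apply: (big_morph (pa_mul g)) => [x y|]; rewrite ?pa_mulDr ?pa_mul0r.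
Qed.

Lemma pa_mulUU p q : pa_mul (pbasis p) (pbasis q) = pbmul p q.
Proof.
rewrite pa_mul.unlock !msupp_pbasis big_seq_fset1 big_seq_fset1.
by rewrite !pa_coefb !eqxx mulr1 scale1r.
Qed.

Lemma pa_ind (P : path_algebra -> Prop) :
    P 0 -> (forall f g, P f -> P g -> P (f + g)) ->
    (forall c f, P f -> P (c *: f)) -> (forall p, P (pbasis p)) ->
  forall f, P f.
Proof.
move=> P0 PD PZ Pb f; rewrite [f]pa_sumE.
by elim/big_rec: _ => // p x _ Px; apply: PD => //; apply: PZ.
Qed.

Lemma pa_mulA : associative pa_mul.
Proof.
move=> f g h; elim/pa_ind: f => [|f f' Ef Ef'|c f Ef|p].
- by rewrite !pa_mul0l.
- by rewrite !pa_mulDl Ef Ef'.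
- by rewrite !pa_mulZl Ef.
elim/pa_ind: g => [|g g' Eg Eg'|c g Eg|q].
- by rewrite pa_mul0l !pa_mul0r pa_mul0l.
- rewrite (pa_mulDl g g' h) (pa_mulDr (pbasis p) g g').
  transitivity (pa_mul (pbasis p) (pa_mul g h) + pa_mul (pbasis p) (pa_mul g' h)).
    exact: pa_mulDr.
  by rewrite Eg Eg'; exact/esym/pa_mulDl.
- rewrite (pa_mulZl c g h) (pa_mulZr c (pbasis p) g).
  transitivity (c *: pa_mul (pbasis p) (pa_mul g h)); first exact: pa_mulZr.
  by rewrite Eg; exact/esym/pa_mulZl.
elim/pa_ind: h => [|h h' Eh Eh'|c h Eh|r].
- by rewrite !pa_mul0r.
- by rewrite !pa_mulDr Eh Eh'.
- by rewrite !pa_mulZr Eh.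
rewrite !pa_mulUU /pbmul; have := pmulA p q r.
case: (pmul q r) => [x|]; case: (pmul p q) => [y|] /= E.
- by rewrite !pa_mulUU /pbmul E.
- by rewrite pa_mul0l pa_mulUU /pbmul E.
- by rewrite pa_mul0r pa_mulUU /pbmul -E.
- by rewrite pa_mul0l pa_mul0r.
Qed.

Lemma pmul_trivl v (p : qpath Q) :
  pmul (ptriv v) p = if v == psrc p then Some p else None.
Proof.
case: eqP => [e|ne]; last exact: pmulN.
by rewrite (@pmulE Q (ptriv v) p e); congr Some; apply: qpath_eq.
Qed.

Lemma pmul_trivr v (p : qpath Q) :
  pmul p (ptriv v) = if v == ptgt p then Some p else None.
Proof.
case: eqP => [e|ne]; last by apply: pmulN => /esym.
rewrite (@pmulE Q p (ptriv v) (esym e)); congr Some; apply: qpath_eq => //.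
by rewrite /parrows /= cats0.
Qed.

Lemma pa_mul1l : left_id pa_one pa_mul.
Proof.
move=> f; elim/pa_ind: f => [|f g Ef Eg|c f Ef|p].
- by rewrite pa_mul0r.
- by rewrite pa_mulDr Ef Eg.
- by rewrite pa_mulZr Ef.
rewrite pa_mul_suml (bigD1 (psrc p)) //= pa_mulUU /pbmul pmul_trivl eqxx /=.
rewrite big1 ?addr0 // => v /negbTE nv.
by rewrite pa_mulUU /pbmul pmul_trivl nv.
Qed.

Lemma pa_mul1r : right_id pa_one pa_mul.
Proof.
move=> f; elim/pa_ind: f => [|f g Ef Eg|c f Ef|p].
- by rewrite pa_mul0l.
- by rewrite pa_mulDl Ef Eg.
- by rewrite pa_mulZl Ef.
rewrite pa_mul_sumr (bigD1 (ptgt p)) //= pa_mulUU /pbmul pmul_trivr eqxx /=.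
rewrite big1 ?addr0 // => v /negbTE nv.
by rewrite pa_mulUU /pbmul pmul_trivr nv.
Qed.

Lemma mcoeff_pa_one v : pa_one@_(ptriv v) = 1.
Proof.
rewrite /pa_one pa_coef_sum (bigD1 v) //= pa_coefb eqxx big1 ?addr0 // => w nw.
rewrite pa_coefb; case: eqP => // /(congr1 (@psrc Q)) e.
by rewrite [w]e eqxx in nw.
Qed.

Lemma pa_one_neq0 : pa_one != 0.
Proof.
have /card_gt0P[v _] := vertex_nonempty Q.
apply/eqP => /(congr1 (fun f : path_algebra => f@_(ptriv v))) /eqP.
by rewrite mcoeff_pa_one pa_coef0 oner_eq0.
Qed.

HB.instance Definition _ := GRing.Zmodule_isNzRing.Build path_algebra
  pa_mulA pa_mul1l pa_mul1r pa_mulDl pa_mulDr pa_one_neq0.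

HB.instance Definition _ := GRing.Lmodule_isLalgebra.Build k path_algebra
  (fun c f g => esym (pa_mulZl c f g)).
HB.instance Definition _ := GRing.Lalgebra_isAlgebra.Build k path_algebra
  (fun c f g => esym (pa_mulZr c f g)).

Lemma pbasisM p q : pbasis p * pbasis q = oapp pbasis 0 (pmul p q).
Proof. exact: pa_mulUU. Qed.

Lemma pa_coefM_triv (f g : path_algebra) v :
  (f * g)@_(ptriv v) = f@_(ptriv v) * g@_(ptriv v).
Proof.
elim/pa_ind: f => [|f f' Ef Ef'|c f Ef|p].
- by rewrite mul0r !pa_coef0 mul0r.
- by rewrite mulrDl !pa_coefD mulrDl Ef Ef'.
- by rewrite -scalerAl !pa_coefZ Ef mulrA.
elim/pa_ind: g => [|g g' Eg Eg'|c g Eg|q].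
- by rewrite mulr0 !pa_coef0 mulr0.
- by rewrite mulrDr !pa_coefD mulrDr Eg Eg'.
- by rewrite -scalerAr !pa_coefZ Eg mulrCA.
rewrite pbasisM !pa_coefb; case: (eqVneq p (ptriv v)) => [->|np].
  rewrite pmul_trivl mul1r; case: (eqVneq q (ptriv v)) => [->|nq].
    by rewrite eqxx /= pa_coefb eqxx.
  by case: ifP => _ /=; rewrite ?pa_coef0 // pa_coefb (negbTE nq).
rewrite mul0r; case: (eqVneq (ptgt p) (psrc q)) => [e|/eqP ne]; last first.
  by rewrite pmulN //= pa_coef0.
rewrite (pmulE e) /= pa_coefb; case: eqP => // /(congr1 (@pword Q)) [e1 e2].
case/eqP: np; apply: qpath_eq => //.
by case: (parrows p) e2.
Qed.

End PathAlgebra.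

Section QuotientAlgebra.
Variables (k : fieldType) (A : algType k) (S : A -> Prop).

Inductive two_sided_ideal : A -> Prop :=
| tsi_zero : two_sided_ideal 0
| tsi_add x y : two_sided_ideal x -> two_sided_ideal y ->
    two_sided_ideal (x + y)
| tsi_gen a s b : S s -> two_sided_ideal (a * s * b).

Lemma tsi_mull a x : two_sided_ideal x -> two_sided_ideal (a * x).
Proof.
elim=> [|y z _ Iy _ Iz|b s c Ss]; first by rewrite mulr0; constructor.
- by rewrite mulrDr; constructor.
- by rewrite !mulrA; constructor.
Qed.

Lemma tsi_mulr a x : two_sided_ideal x -> two_sided_ideal (x * a).
Proof.
elim=> [|y z _ Iy _ Iz|b s c Ss]; first by rewrite mul0r; constructor.
- by rewrite mulrDl; constructor.
- by rewrite -[_ * a]mulrA; constructor.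
Qed.

Lemma tsi_scale (c : k) x : two_sided_ideal x -> two_sided_ideal (c *: x).
Proof. by move=> Ix; rewrite -[x]mul1r scalerAl; apply: tsi_mull. Qed.

Definition ideal_pred : {pred A} := fun x => `[< two_sided_ideal x >].

Lemma ideal_predP x : reflect (two_sided_ideal x) (x \in ideal_pred).
Proof. exact: asboolP. Qed.

Lemma ideal_pred_zmod : zmod_closed ideal_pred.
Proof.
split=> [|x y /ideal_predP Ix /ideal_predP Iy]; apply/ideal_predP.
  exact: tsi_zero.
by apply: tsi_add => //; rewrite -scaleN1r; apply: tsi_scale.
Qed.

HB.instance Definition _ := GRing.isZmodClosed.Build A ideal_pred
  ideal_pred_zmod.

(* The properness hypothesis is part of the type because an algType has      *)
(* 1 != 0.                                                                   *)
Definition quot_algebra (proper : ~ two_sided_ideal 1) : Type :=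
  Quotient.quot ideal_pred.

Variable proper : ~ two_sided_ideal 1.
Local Notation quot := (quot_algebra proper).

HB.instance Definition _ := Choice.on quot.
HB.instance Definition _ := GRing.Zmodule.on quot.
HB.instance Definition _ := EqQuotient.on quot.

Definition quot_pi (x : A) : quot := \pi_quot x.

Lemma quot_piP x y : quot_pi x = quot_pi y <-> two_sided_ideal (x - y).
Proof.
split=> [/eqP|I]; last apply/eqP.
  by rewrite /quot_pi -Quotient.idealrBE => /ideal_predP.
by rewrite /quot_pi -Quotient.idealrBE; apply/ideal_predP.
Qed.

Lemma quot_piK (x : quot) : quot_pi (repr x) = x.
Proof. exact: reprK. Qed.

Lemma quot_piD x y : quot_pi (x + y) = quot_pi x + quot_pi y.
Proof. exact: Quotient.pi_add. Qed.

Definition quot_mul (x y : quot) : quot := quot_pi (repr x * repr y).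
Definition quot_scale (c : k) (x : quot) : quot := quot_pi (c *: repr x).

Lemma quot_piM x y : quot_mul (quot_pi x) (quot_pi y) = quot_pi (x * y).
Proof.
apply/quot_piP; set x' := repr _; set y' := repr _.
have Ix : two_sided_ideal (x' - x) by apply/quot_piP; exact: quot_piK.
have Iy : two_sided_ideal (y' - y) by apply/quot_piP; exact: quot_piK.
have -> : x' * y' - x * y = (x' - x) * y' + x * (y' - y).
  by rewrite mulrBl mulrBr addrA subrK.
by apply: tsi_add; [apply: tsi_mulr|apply: tsi_mull].
Qed.

Lemma quot_piZ c x : quot_scale c (quot_pi x) = quot_pi (c *: x).
Proof.
apply/quot_piP; rewrite -scalerBr; apply: tsi_scale.
by apply/quot_piP; exact: quot_piK.
Qed.

Lemma quot_mulA : associative quot_mul.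
Proof.
move=> x y z; rewrite -(quot_piK x) -(quot_piK y) -(quot_piK z).
by rewrite !quot_piM mulrA.
Qed.

Lemma quot_mul1l : left_id (quot_pi 1) quot_mul.
Proof. by move=> x; rewrite -(quot_piK x) quot_piM mul1r. Qed.

Lemma quot_mul1r : right_id (quot_pi 1) quot_mul.
Proof. by move=> x; rewrite -(quot_piK x) quot_piM mulr1. Qed.

Lemma quot_mulDl : left_distributive quot_mul +%R.
Proof.
move=> x y z; rewrite -(quot_piK x) -(quot_piK y) -(quot_piK z).
by rewrite -quot_piD !quot_piM -quot_piD mulrDl.
Qed.

Lemma quot_mulDr : right_distributive quot_mul +%R.
Proof.
move=> x y z; rewrite -(quot_piK x) -(quot_piK y) -(quot_piK z).
by rewrite -quot_piD !quot_piM -quot_piD mulrDr.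
Qed.

Lemma quot_one_neq0 : quot_pi 1 != 0.
Proof.
have e : quot_pi 0 = 0.
  by apply: (addrI (quot_pi 0)); rewrite -quot_piD !addr0.
apply/eqP; rewrite -e => /quot_piP; rewrite subr0; exact: proper.
Qed.

HB.instance Definition _ := GRing.Zmodule_isNzRing.Build quot
  quot_mulA quot_mul1l quot_mul1r quot_mulDl quot_mulDr quot_one_neq0.

Lemma quot_scaleA c d x : quot_scale c (quot_scale d x) = quot_scale (c * d) x.
Proof. by rewrite -(quot_piK x) !quot_piZ scalerA. Qed.

Lemma quot_scale1 : left_id 1 quot_scale.
Proof. by move=> x; rewrite -(quot_piK x) quot_piZ scale1r. Qed.

Lemma quot_scaleDr : right_distributive quot_scale +%R.
Proof.
move=> c x y; rewrite -(quot_piK x) -(quot_piK y).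
by rewrite -quot_piD !quot_piZ -quot_piD scalerDr.
Qed.

Lemma quot_scaleDl x : {morph quot_scale^~ x : c d / c + d}.
Proof. by move=> c d; rewrite -(quot_piK x) !quot_piZ -quot_piD scalerDl. Qed.

HB.instance Definition _ := GRing.Zmodule_isLmodule.Build k quot
  quot_scaleA quot_scale1 quot_scaleDr quot_scaleDl.

Lemma quot_scaleAl c (x y : quot) : c *: (x * y) = c *: x * y.
Proof.
rewrite -(quot_piK x) -(quot_piK y).
change (quot_scale c (quot_mul (quot_pi (repr x)) (quot_pi (repr y))) =
  quot_mul (quot_scale c (quot_pi (repr x))) (quot_pi (repr y))).
by rewrite quot_piZ !quot_piM quot_piZ scalerAl.
Qed.

Lemma quot_scaleAr c (x y : quot) : c *: (x * y) = x * (c *: y).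
Proof.
rewrite -(quot_piK x) -(quot_piK y).
change (quot_scale c (quot_mul (quot_pi (repr x)) (quot_pi (repr y))) =
  quot_mul (quot_pi (repr x)) (quot_scale c (quot_pi (repr y)))).
by rewrite quot_piZ !quot_piM quot_piZ scalerAr.
Qed.

HB.instance Definition _ := GRing.Lmodule_isLalgebra.Build k quot quot_scaleAl.
HB.instance Definition _ := GRing.Lalgebra_isAlgebra.Build k quot quot_scaleAr.

End QuotientAlgebra.

(* The vertices 1, ..., n are numbered from 0; an arrow is a pair            *)
(* (source, target) of neighbours, so there is one arrow i -> i+1 and one    *)
(* arrow i+1 -> i for each i.                                                *)
Section Cn.
Variables (k : fieldType) (n : nat) (hn : (2 <= n)%N).

Definition Cn_arrow : finType :=
  {x : 'I_n * 'I_n | (x.1.+1 == x.2 :> nat) || (x.2.+1 == x.1 :> nat)}.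

Lemma Cn_vertex_nonempty : (0 < #|{: 'I_n}|)%N.
Proof. by rewrite card_ord; apply: ltn_trans hn. Qed.

Definition Cn_quiver : quiver :=
  @Quiver 'I_n Cn_arrow (fun a => (val a).1) (fun a => (val a).2)
    Cn_vertex_nonempty.

Local Notation cpath := (qpath Cn_quiver).

Inductive Cn_relation : path_algebra k Cn_quiver -> Prop :=
| Cn_length3 (p : cpath) : plength p = 3%N -> Cn_relation (pbasis k p)
| Cn_noncycle (p : cpath) : plength p = 2%N -> psrc p <> ptgt p ->
    Cn_relation (pbasis k p)
| Cn_cycles (p q : cpath) : plength p = 2%N -> plength q = 2%N ->
    psrc p = ptgt p -> psrc q = ptgt q -> psrc p = psrc q ->
    Cn_relation (pbasis k p - pbasis k q)
| Cn_last (p : cpath) : plength p = 2%N -> psrc p = ptgt p ->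
    (psrc p : 'I_n).+1 = n -> Cn_relation (pbasis k p)
| Cn_first (p : cpath) : plength p = 2%N -> psrc p = ptgt p ->
    (psrc p : 'I_n) = 0%N :> nat -> Cn_relation (pbasis k p).

Lemma Cn_ideal_coef v x :
  two_sided_ideal Cn_relation x -> x@_(ptriv v) = 0.
Proof.
have cb (p : cpath) : (0 < plength p)%N -> (pbasis k p)@_(ptriv v) = 0.
  by move=> hp; rewrite pa_coefb; case: eqP hp => // ->.
have cs s : Cn_relation s -> s@_(ptriv v) = 0.
  case=> [p e|p e _|p q e1 e2 _ _ _|p e _ _|p e _ _]; try by rewrite cb // e.
  by rewrite -scaleN1r pa_coefD pa_coefZ !cb ?e1 ?e2 // mulr0 addr0.
elim=> [|a b _ Ea _ Eb|a s b /cs Es]; first exact: pa_coef0.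
  by rewrite pa_coefD Ea Eb addr0.
by rewrite !pa_coefM_triv Es mulr0 mul0r.
Qed.

Lemma Cn_proper : ~ two_sided_ideal Cn_relation 1.
Proof.
have /card_gt0P[v _] := Cn_vertex_nonempty.
by move=> /(@Cn_ideal_coef v)/eqP; rewrite mcoeff_pa_one oner_eq0.
Qed.

Definition C_algebra : algType k := quot_algebra Cn_proper.

End Cn.

(* Right modules, finite-dimensional because the carrier is a vectType.      *)
Record rmodule (k : fieldType) (L : algType k) := RModule {
  rcarrier :> vectType k;
  ract : rcarrier -> L -> rcarrier;
  ract_linl : forall a, linear (ract^~ a);
  ract_linr : forall x, linear (ract x);
  ract1 : forall x, ract x 1 = x;
  ractM : forall x a b, ract x (a * b) = ract (ract x a) b }.

Record rhom (k : fieldType) (L : algType k) (M N : rmodule L) := RHom {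
  rhom_fun :> M -> N;
  rhom_linear : linear rhom_fun;
  rhom_act : forall x a, rhom_fun (ract x a) = ract (rhom_fun x) a }.

HB.instance Definition _ (k : fieldType) (L : algType k) (M N : rmodule L)
    (f : rhom M N) :=
  GRing.isLinear.Build k M N _ (rhom_fun f) (rhom_linear f).

#[local] Obligation Tactic := idtac.

Section Modules.
Variables (k : fieldType) (L : algType k).
Implicit Types (M N P X Y : rmodule L).

Lemma ractD M (x y : M) a : ract (x + y) a = ract x a + ract y a.
Proof. by have := ract_linl a 1 x y; rewrite !scale1r. Qed.

Lemma ract0 M a : ract (0 : M) a = 0.
Proof. by apply: (addrI (ract 0 a)); rewrite -ractD !addr0. Qed.

Lemma ractN M (x : M) a : ract (- x) a = - ract x a.
Proof. by apply: (addrI (ract x a)); rewrite -ractD !subrr ract0. Qed.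

Lemma rhom_add M N (f : rhom M N) x y : f (x + y) = f x + f y.
Proof. exact: raddfD. Qed.

Lemma rhom_opp M N (f : rhom M N) x : f (- x) = - f x.
Proof. exact: raddfN. Qed.

Program Definition rmod0 : rmodule L :=
  @RModule k L 'rV[k]_0 (fun x _ => x) _ _ _ _.
Next Obligation. by move=> a c x y. Qed.
Next Obligation. by move=> x c a b; rewrite [LHS]thinmx0 [RHS]thinmx0. Qed.
Next Obligation. by []. Qed.
Next Obligation. by []. Qed.

Program Definition rprod M N : rmodule L :=
  @RModule k L (M * N)%type (fun x a => (ract x.1 a, ract x.2 a)) _ _ _ _.
Next Obligation. by move=> M N a c x y; congr (_, _); apply: ract_linl. Qed.
Next Obligation. by move=> M N x c a b; congr (_, _); apply: ract_linr. Qed.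
Next Obligation. by move=> M N [x y]; rewrite !ract1. Qed.
Next Obligation. by move=> M N x a b /=; rewrite !ractM. Qed.

Program Definition rhom0 M N : rhom M N := @RHom k L M N (fun _ => 0) _ _.
Next Obligation. by move=> M N c x y; rewrite scaler0 addr0. Qed.
Next Obligation. by move=> M N x a; rewrite ract0. Qed.

Program Definition rhomN M N (f : rhom M N) : rhom M N :=
  @RHom k L M N (fun x => - f x) _ _.
Next Obligation. by move=> M N f c x y /=; rewrite linearP opprD scalerN. Qed.
Next Obligation. by move=> M N f x a /=; rewrite rhom_act ractN. Qed.

Definition projective P : Prop :=
  forall X Y (g : rhom X Y) (f : rhom P Y), (forall y, exists x, g x = y) ->
  exists h : rhom P X, forall z, g (h z) = f z.

Record proj_resolution M := ProjResolution {
  pr_obj : nat -> rmodule L;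
  pr_proj : forall i, projective (pr_obj i);
  pr_d : forall i, rhom (pr_obj i.+1) (pr_obj i);
  pr_aug : rhom (pr_obj 0) M;
  pr_aug_surj : forall y, exists x, pr_aug x = y;
  pr_exact0 : forall x, pr_aug x = 0 <-> exists y, pr_d 0 y = x;
  pr_exactS : forall i x, pr_d i x = 0 <-> exists y, pr_d i.+1 y = x }.

Definition Hom_cohomology_zero M (P : proj_resolution M) N (i : nat) : Prop :=
  forall f : rhom (pr_obj P i) N, (forall x, f (pr_d P i x) = 0) ->
  match i return rhom (pr_obj P i) N -> Prop with
  | 0%N => fun f => forall x, f x = 0
  | j.+1 => fun f => exists g : rhom (pr_obj P j) N,
      forall x, f x = g (pr_d P j x)
  end f.

(* Ext^i(M, N) = 0. The groups computed from two resolutions are isomorphic, *)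
(* and resolutions by finite-dimensional projectives exist as soon as L is   *)
(* finite-dimensional.                                                       *)
Definition Ext_zero (i : nat) M N : Prop :=
  forall P : proj_resolution M, Hom_cohomology_zero P N i.

(* Hom(M, M) = k: every endomorphism is multiplication by a scalar, which is *)
(* unique (so that M is nonzero).                                            *)
Definition exceptional M : Prop :=
  (forall f : rhom M M, exists! c : k, forall x, f x = c *: x) /\
  (forall i, (0 < i)%N -> Ext_zero i M M).

Definition exceptional_sequence (m : nat) (M : 'I_m -> rmodule L) : Prop :=
  (forall t, exceptional (M t)) /\
  (forall s t : 'I_m, (s < t)%N -> forall i, Ext_zero i (M t) (M s)).

Record bcomplex := BComplex {
  cobj :> int -> rmodule L;
  cdiff : forall i, rhom (cobj i) (cobj (i + 1));
  cdiff2 : forall i x, cdiff (i + 1) (cdiff i x) = 0;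
  cbounded : exists b : nat,
    forall i, (b < absz i)%N -> forall x : cobj i, x = 0 }.

Record cmap (X Y : bcomplex) := CMap {
  cmap_fun :> forall i, rhom (X i) (Y i);
  cmap_diff : forall i x, cmap_fun (i + 1) (cdiff X i x) =
                          cdiff Y i (cmap_fun i x) }.

(* Injectivity and surjectivity on H^(i+1), for every integer i.             *)
Definition quasi_iso (X Y : bcomplex) (f : cmap X Y) : Prop :=
  forall i : int,
  (forall x : X (i + 1), cdiff X (i + 1) x = 0 ->
     (exists y, f (i + 1) x = cdiff Y i y) -> exists x', x = cdiff X i x') /\
  (forall y : Y (i + 1), cdiff Y (i + 1) y = 0 ->
     exists (x : X (i + 1)) (y' : Y i), cdiff X (i + 1) x = 0 /\
       y = f (i + 1) x + cdiff Y i y').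

(* Isomorphism in the derived category: a roof of quasi-isomorphisms.        *)
Definition derived_iso (X Y : bcomplex) : Prop :=
  exists (Z : bcomplex) (f : cmap Z X) (g : cmap Z Y),
    quasi_iso f /\ quasi_iso g.

Definition stalk_obj M (i : int) : rmodule L :=
  if i is Posz 0 then M else rmod0.

Program Definition stalk M : bcomplex :=
  @BComplex (stalk_obj M) (fun i => rhom0 _ _) _ _.
Next Obligation. by []. Qed.
Next Obligation. by move=> M; exists 0%N => -[[|i]|i] // _ x; apply: thinmx0. Qed.

Program Definition shift (X : bcomplex) : bcomplex :=
  @BComplex (fun i => X (i + 1)) (fun i => rhomN (cdiff X (i + 1))) _ _.
Next Obligation. by move=> X i x /=; rewrite rhom_opp cdiff2 !oppr0. Qed.
Next Obligation.
move=> X; have [b hb] := cbounded X; exists b.+1 => i hi x; apply: hb.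
lia.
Qed.

Section Cone.
Variables (X Y : bcomplex) (f : cmap X Y).

Definition cone_obj (i : int) : rmodule L := rprod (X (i + 1)) (Y i).

Program Definition cone_diff i : rhom (cone_obj i) (cone_obj (i + 1)) :=
  @RHom k L (cone_obj i) (cone_obj (i + 1))
    (fun z => (- cdiff X (i + 1) z.1, f (i + 1) z.1 + cdiff Y i z.2)) _ _.
Next Obligation.
move=> i c x y; congr (_, _) => /=; first by rewrite linearP opprD scalerN.
by rewrite !linearP /= scalerDr addrACA.
Qed.
Next Obligation.
by move=> i x a; congr (_, _) => /=; rewrite !rhom_act ?ractN ?ractD.
Qed.

Program Definition cone : bcomplex := @BComplex cone_obj cone_diff _ _.
Next Obligation.
move=> i x /=; congr (_, _); first by rewrite rhom_opp cdiff2 !oppr0.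
by rewrite rhom_opp rhom_add cdiff2 addr0 cmap_diff addNr.
Qed.
Next Obligation.
have [b hb] := cbounded X; have [c hc] := cbounded Y.
exists (b + c).+1 => i hi [x y]; congr (_, _); [apply: hb|apply: hc]; lia.
Qed.

End Cone.

(* Strictly full triangulated subcategories, given by their objects.  Up to  *)
(* isomorphism every morphism is represented by a chain map, and its cone is *)
(* the mapping cone.                                                         *)
Record triangulated_subcategory (T : bcomplex -> Prop) : Prop := {
  tri_zero : forall X : bcomplex, (forall i (x : X i), x = 0) -> T X;
  tri_iso : forall X Y : bcomplex, derived_iso X Y -> T X -> T Y;
  tri_shift : forall X : bcomplex, T (shift X) <-> T X;
  tri_cone : forall (X Y : bcomplex) (f : cmap X Y), T X -> T Y -> T (cone f) }.

Definition generates_derived (m : nat) (M : 'I_m -> rmodule L) : Prop :=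
  forall T, triangulated_subcategory T -> (forall t, T (stalk (M t))) ->
  forall X : bcomplex, T X.

Definition full_exceptional_sequence (m : nat) (M : 'I_m -> rmodule L) : Prop :=
  exceptional_sequence M /\ generates_derived M.

End Modules.

(* Main.v *)
(* Let xx be the sum of all arrows, with signs making the two cycles at each
   vertex cancel.  Then xx^2 = 0, and together with the grading by vertices this
   is the whole presentation of C_n, which therefore has the flat deformation
   xx^2 = t.  A module M with Ext^2(M, M) = 0 lifts along this deformation to
   first order, with operator xx + t y say; then y xx + xx y = 1, so that xx is
   exact on M.  As xx exchanges even and odd vertices, the even and odd parts of
   M have the same dimension.  The complexes whose Euler characteristic with
   respect to (even dimension) - (odd dimension) vanishes form a triangulated
   subcategory that contains all exceptional modules but no simple module. *)

Require Import Defs.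
From HB Require Import structures.
From mathcomp Require Import all_boot all_algebra.
From mathcomp Require Import boolp finmap monalg zify.

Set Implicit Arguments.
Unset Strict Implicit.
Unset Printing Implicit Defensive.

Import GRing.Theory.
Local Open Scope ring_scope.

#[local] Obligation Tactic := idtac.

Lemma linear_at0 (k : fieldType) (U V : lmodType k) (f : U -> V) : linear f -> f 0 = 0.
Proof.
by move=> fl; have := fl (-1) 0 0; rewrite scaler0 addr0 scaleN1r addNr.
Qed.

(** * Resolutions from enough projectives *)

Section Modules.
Variables (k : fieldType) (L : algType k).
Implicit Types (M N P : rmodule L).

Lemma ractDr M (x : M) a b : ract x (a + b) = ract x a + ract x b.
Proof. by have := ract_linr x 1 a b; rewrite !scale1r. Qed.

Lemma ractr0 M (x : M) : ract x 0 = 0.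
Proof. by apply: (addrI (ract x 0)); rewrite -ractDr !addr0. Qed.

Lemma ractZr M (x : M) c a : ract x (c *: a) = c *: ract x a.
Proof. by have := ract_linr x c a 0; rewrite !addr0 ractr0 addr0. Qed.

Lemma ractZ M (x : M) c a : ract (c *: x) a = c *: ract x a.
Proof. by have := ract_linl a c x 0; rewrite !addr0 ract0 addr0. Qed.

Lemma ractr_sum M (x : M) (I : Type) (r : seq I) (p : pred I) (F : I -> L) :
  ract x (\sum_(i <- r | p i) F i) = \sum_(i <- r | p i) ract x (F i).
Proof.
by apply: (big_morph (ract x)) => [a b|]; rewrite ?ractDr ?ractr0.
Qed.

(** A named function, so that it can carry a linear structure and be passed to [linfun]. *)
Definition ractf M (a : L) : M -> M := fun x => ract x a.
HB.instance Definition _ M a :=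
  GRing.isLinear.Build k M M _ (ractf a) (ract_linl a).

Program Definition rhom_id M : rhom M M := @RHom k L M M id _ _.
Next Obligation. by []. Qed.
Next Obligation. by []. Qed.

Program Definition rhom_comp M N P (g : rhom N P) (f : rhom M N) : rhom M P :=
  @RHom k L M P (g \o f) _ _.
Next Obligation. by move=> M N P g f c x y /=; rewrite !linearP. Qed.
Next Obligation. by move=> M N P g f x a /=; rewrite !rhom_act. Qed.

Program Definition rhom_inl M N : rhom M (rprod M N) :=
  @RHom k L M (rprod M N) (fun x => (x, 0)) _ _.
Next Obligation.
by move=> M N c x y; congr (_, _); rewrite /= scaler0 addr0.
Qed.
Next Obligation. by move=> M N x a; congr (_, _); rewrite /= ract0. Qed.

Program Definition rhom_inr M N : rhom N (rprod M N) :=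
  @RHom k L N (rprod M N) (fun x => (0, x)) _ _.
Next Obligation.
by move=> M N c x y; congr (_, _); rewrite /= scaler0 addr0.
Qed.
Next Obligation. by move=> M N x a; congr (_, _); rewrite /= ract0. Qed.

Program Definition rhom_copair M N P (f : rhom M P) (g : rhom N P) :
    rhom (rprod M N) P :=
  @RHom k L (rprod M N) P (fun z => f z.1 + g z.2) _ _.
Next Obligation.
by move=> M N P f g c x y /=; rewrite !linearP /= scalerDr addrACA.
Qed.
Next Obligation. by move=> M N P f g x a /=; rewrite !rhom_act ractD. Qed.

Lemma projective0 : projective (rmod0 L).
Proof.
move=> X Y g f _; exists (rhom0 _ X) => z /=.
by rewrite [z]thinmx0 !linear0.
Qed.

Lemma projective_prod M N :
  projective M -> projective N -> projective (rprod M N).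
Proof.
move=> PM PN X Y g f gs.
have [h1 e1] := PM X Y g (rhom_comp f (rhom_inl M N)) gs.
have [h2 e2] := PN X Y g (rhom_comp f (rhom_inr M N)) gs.
exists (rhom_copair h1 h2) => z /=.
rewrite linearD /= e1 e2 /= -linearD /=; congr (f _).
by rewrite [RHS]surjective_pairing; congr (_, _); rewrite /= ?addr0 ?add0r.
Qed.

(* The hypotheses hold for the right ideal [u L] with its generator [e = u]. *)
Lemma projective_cyclic P (e : P) (u : L) :
    u * u = u -> ract e u = e -> (forall z : P, exists a, z = ract e a) ->
    (forall (X : rmodule L) (x : X), ract x u = x ->
      exists h : rhom P X, h e = x) ->
  projective P.
Proof.
move=> uu eu gen ext X Y g f gs.
have [x0 gx0] := gs (f e).
(* The preimage [x0] of [f e] need not be fixed by [u], but [x0 u] is, and it has the same image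
   because [e u = e]. *)
have [h he] := ext X (ract x0 u) ltac:(by rewrite -ractM uu).
exists h => z; have [a ->] := gen z.
by rewrite !rhom_act he rhom_act gx0 -rhom_act eu.
Qed.

Section Kernel.
Variables (M N : rmodule L) (f : rhom M N).

Definition rker_space : {vspace M} := lker (linfun f).

Lemma mem_rker x : (x \in rker_space) = (f x == 0).
Proof. by rewrite memv_ker lfunE. Qed.

Lemma rker_act (x : subvs_of rker_space) a : ract (vsval x) a \in rker_space.
Proof.
by rewrite mem_rker rhom_act; have := subvsP x; rewrite mem_rker => /eqP->;
  rewrite ract0.
Qed.

Program Definition rker : rmodule L :=
  @RModule k L (subvs_of rker_space) (fun x a => Subvs (rker_act x a)) _ _ _ _.
Next Obligation. by move=> a c x y; apply: val_inj; rewrite /= ract_linl. Qed.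
Next Obligation. by move=> x c a b; apply: val_inj; rewrite /= ract_linr. Qed.
Next Obligation. by move=> x; apply: val_inj; rewrite /= ract1. Qed.
Next Obligation. by move=> x a b; apply: val_inj; rewrite /= ractM. Qed.

Program Definition rker_inc : rhom rker M :=
  @RHom k L rker M (fun x => vsval x) _ _.
Next Obligation. by move=> c x y. Qed.
Next Obligation. by []. Qed.

Lemma rker_incP x : f x = 0 <-> exists y, rker_inc y = x.
Proof.
split=> [/eqP|[y <-]]; first by rewrite -mem_rker => fx; exists (Subvs fx).
by apply/eqP; rewrite -mem_rker; exact: subvsP.
Qed.

Lemma rker_inc_inj y : rker_inc y = 0 -> y = 0.
Proof. by move=> e; apply: val_inj. Qed.

End Kernel.

Section Resolution.
Variables (cov : rmodule L -> rmodule L) (cov_hom : forall M, rhom (cov M) M).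
Hypothesis cov_proj : forall M, projective (cov M).
Hypothesis cov_surj : forall M y, exists x, cov_hom M x = y.
Variable M : rmodule L.

Fixpoint syzygy (i : nat) : rmodule L :=
  if i is j.+1 then rker (cov_hom (syzygy j)) else M.

Definition cov_diff i : rhom (cov (syzygy i.+1)) (cov (syzygy i)) :=
  rhom_comp (rker_inc (cov_hom (syzygy i))) (cov_hom (syzygy i.+1)).

Lemma cov_diff_exact i x :
  cov_hom (syzygy i) x = 0 <-> exists y, cov_diff i y = x.
Proof.
split=> [/rker_incP[y <-]|[y <-]]; last by apply/rker_incP; eexists.
by have [z <-] := cov_surj y; exists z.
Qed.

Lemma cov_diff0 i x : cov_diff i x = 0 <-> cov_hom (syzygy i.+1) x = 0.
Proof. by split=> [/rker_inc_inj //|e]; rewrite /= e. Qed.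

(** Splices the covers of the iterated kernels. It is transparent, so that the term in degree 0
    computes to [cov M]. *)
Definition cov_resolution : proj_resolution M.
Proof.
refine (@ProjResolution k L M (fun i => cov (syzygy i)) (fun i => @cov_proj _)
  cov_diff (cov_hom M) (@cov_surj M) (@cov_diff_exact 0) _).
by move=> i x; rewrite (propext (cov_diff0 x)); exact: cov_diff_exact.
Defined.

End Resolution.

End Modules.
(** * Vanishing Euler characteristic *)

Section EulerForm.
Variables (k : fieldType) (L : algType k).
Implicit Types (M N : rmodule L) (X Y Z : bcomplex L).

(** Every integer has the form [i + 1]; this form avoids transporting the incoming differential
    along an equality of degrees. *)
Definition exact_complex X : Prop :=
  forall i (x : X (i + 1)), cdiff X (i + 1) x = 0 -> exists y, x = cdiff X i y.

(** Injectivity on cohomology makes the first component of a cocycle a coboundary; surjectivity one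
    degree lower then corrects the second component. *)
Lemma cone_exact X Y (f : cmap X Y) : quasi_iso f -> exact_complex (cone f).
Proof.
move=> qf i [x y] /= [/eqP]; rewrite oppr_eq0 => /eqP dx fxy.
have [inj _] := qf (i + 1).
have [|x' ex'] := inj x dx.
  by exists (- y); rewrite rhom_opp; apply/eqP; rewrite -addr_eq0 fxy.
have [_ surj] := qf i.
have [|x'' [y' [dx'' ey]]] := surj (f (i + 1) x' + y).
  by rewrite linearD /= -cmap_diff -ex' fxy.
exists (x'' - x', y'); congr (_, _) => /=.
  by rewrite linearB /= dx'' sub0r opprK.
by rewrite linearB /= addrAC -ey addrC addKr.
Qed.

Section Idempotent.
Variables (e : L) (ee : e * e = e).

Definition espace M : {vspace M} := limg (linfun (ractf (M := M) e)).

Lemma espaceP M (x : M) : reflect (ract x e = x) (x \in espace M).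
Proof.
apply: (iffP memv_imgP) => [[y _ ->]|xe].
  by rewrite lfunE /= /ractf -ractM ee.
by exists x; rewrite ?memvf // lfunE.
Qed.

Lemma espace_hom M N (f : rhom M N) x : x \in espace M -> f x \in espace N.
Proof. by move=> /espaceP xe; apply/espaceP; rewrite -rhom_act xe. Qed.

Lemma dim_espace_prod M N :
  \dim (espace (rprod M N)) = (\dim (espace M) + \dim (espace N))%N.
Proof.
set f := linfun (rhom_copair (rhom_id M) (rhom0 N M)).
set g := linfun (rhom_inr M N).
have gE y : g y = (0, y) by exact: (lfunE (rhom_inr M N)).
rewrite -(limg_ker_dim f (espace (rprod M N))) addnC; congr (_ + _)%N.
  congr (\dim _); apply/vspaceP => x; apply/memv_imgP/idP.
    move=> [[y z] yz ->]; rewrite lfunE /= addr0.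
    by move/espaceP: yz => [ye _]; apply/espaceP.
  move=> /espaceP xe; exists (x, 0); last by rewrite lfunE /= addr0.
  by apply/espaceP; rewrite /= xe ract0.
have -> : (espace (rprod M N) :&: lker f)%VS = (g @: espace N)%VS.
  apply/vspaceP => -[x y]; rewrite memv_cap memv_ker lfunE /= addr0.
  apply/andP/memv_imgP.
    move=> [/(@espaceP (rprod M N))/(congr1 snd) ye /eqP x0].
    exists y; first exact/espaceP.
    by rewrite gE x0.
  move=> [z ze]; rewrite gE => -[-> ->]; split=> //.
  exact: (espace_hom (rhom_inr M N) ze).
rewrite limg_dim_eq //; apply/eqP; rewrite -subv0; apply/subvP => x.
rewrite memv_cap memv_ker gE => /andP[_ /eqP[->]]; exact: mem0v.
Qed.

Lemma dim_espace0 M : (forall x : M, x = 0) -> \dim (espace M) = 0%N.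
Proof.
move=> M0; apply/eqP; rewrite dimv_eq0 -subv0; apply/subvP => x _.
by rewrite (M0 x) mem0v.
Qed.

(** The functor taking [M] to [M e] is exact, since a preimage [y] of an element fixed by [e] may be
    replaced by [y e]. The rest is rank-nullity. *)
Lemma dim_espace_exact X : exact_complex X -> forall i : int,
  \dim (espace (X (i + 1))) =
    (\dim (linfun (cdiff X i) @: espace (X i))
     + \dim (linfun (cdiff X (i + 1)%R) @: espace (X (i + 1)%R)))%N.
Proof.
move=> ex i; rewrite -(limg_ker_dim (linfun (cdiff X (i + 1)))).
congr (\dim _ + _)%N; apply/vspaceP => x; rewrite memv_cap memv_ker lfunE /=.
apply/andP/memv_imgP => [[/espaceP xe /eqP/ex[y ey]]|[y ye ->]].
  exists (ract y e); first by apply/espaceP; rewrite -ractM ee.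
  by rewrite lfunE /= rhom_act -ey xe.
rewrite lfunE /= cdiff2; split=> //; exact: espace_hom ye.
Qed.

End Idempotent.

Variables (e0 e1 : L).
Hypotheses (e0P : e0 * e0 = e0) (e1P : e1 * e1 = e1).

Definition sdim M : int := (\dim (espace e0 M))%:Z - (\dim (espace e1 M))%:Z.

Lemma sdim_prod M N : sdim (rprod M N) = sdim M + sdim N.
Proof. by rewrite /sdim !dim_espace_prod // !PoszD opprD addrACA. Qed.

Lemma sdim0 M : (forall x : M, x = 0) -> sdim M = 0.
Proof. by move=> M0; rewrite /sdim !dim_espace0 // subrr. Qed.

(* Says that the Euler characteristic of [sdim] vanishes, avoiding sums over an
   interval containing the support: [s i] is the partial alternating sum
   [sdim (X i) - sdim (X (i - 1)) + ...]. *)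
Definition euler_zero X : Prop := exists s : int -> int,
  (exists b : nat, forall i, (b < absz i)%N -> s i = 0) /\
  forall i, sdim (X (i + 1)) = s i + s (i + 1).

(** The partial alternating sums of an exact complex are the signed ranks of its differentials, by
    [dim_espace_exact]. *)
Lemma exact_euler_zero X : exact_complex X -> euler_zero X.
Proof.
move=> ex; pose r e i := (\dim (linfun (cdiff X i) @: espace e (X i)))%:Z.
exists (fun i => r e0 i - r e1 i); split=> [|i]; last first.
  by rewrite /sdim !dim_espace_exact // !PoszD -!/(r _ _) opprD addrACA.
have [b Xb] := cbounded X; exists b => i bi.
suff r0 e : r e i = 0 by rewrite !r0 subrr.
rewrite /r; apply/eqP; rewrite eqz_nat dimv_eq0 -subv0; apply/subvP => y.
by move=> /memv_imgP[x _ ->]; rewrite (Xb i bi x) linear0 mem0v.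
Qed.

Lemma sdim_cone X Y (f : cmap X Y) i :
  sdim (cone f i) = sdim (X (i + 1)) + sdim (Y i).
Proof. exact: sdim_prod. Qed.

Lemma euler_zero_tri : triangulated_subcategory euler_zero.
Proof.
split=> [X X0|X Y [Z [f [g [qf qg]]]] TX|X|X Y f].
- exists (fun=> 0); split=> [|i]; first by exists 0%N.
  by rewrite sdim0.
- have [s [[b sb] sX]] := TX.
  have [r [[c rc] rX]] := exact_euler_zero (cone_exact qf).
  have [t [[d td] tX]] := exact_euler_zero (cone_exact qg).
  (* The cones over [X] and over [Y] share the contribution of [Z], which cancels in [t - r]; what
     remains is the difference between [Y] and [X]. *)
  exists (fun i => s i + t i - r i); split=> [|i].
    by exists (b + c + d)%N => i hi; rewrite sb ?rc ?td //; lia.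
  have := rX i; have := tX i; have := sX i.
  rewrite !sdim_cone; lia.
- split=> -[s [[b sb] sX]].
    exists (fun i => s (i - 1)); split=> [|i].
      by exists b.+1 => i hi; apply: sb; lia.
    by rewrite addrK -[in s i](subrK 1 i) -sX /= !subrK.
  exists (fun i => s (i + 1)); split=> [|i]; last exact: sX.
  by exists b.+1 => i hi; apply: sb; lia.
move=> [s [[b sb] sX]] [t [[c tc] tY]].
exists (fun i => s (i + 1) + t i); split=> [|i].
  by exists (b + c).+1 => i hi; rewrite sb ?tc //; lia.
by rewrite sdim_cone sX tY addrACA.
Qed.

Lemma euler_zero_stalk M : euler_zero (stalk M) <-> sdim M = 0.
Proof.
split=> [[s [[b sb] sM]]|M0]; last first.
  exists (fun=> 0); split=> [|i]; first by exists 0%N.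
  rewrite addr0 /=; case: (i + 1) => [[|j]|j] //=; apply: sdim0 => x;
    exact: thinmx0.
(* Away from degree 0 the relation reads [s (i + 1) = - s i], so vanishing far out propagates
   inwards from both sides, up to [s 0] and [s (-1)]. The sum of these two is [sdim M]. *)
have pos j : s (Posz j) = 0.
  have step (i : nat) : s (Posz i) = 0 <-> s (Posz i.+1) = 0.
    have := sM (Posz i); rewrite -[Posz i + 1]/(Posz (i + 1)) addn1 /=.
    rewrite sdim0; last by move=> x; exact: thinmx0.
    lia.
  have : s (Posz (j + b.+1)) = 0 by apply: sb => /=; lia.
  elim: b.+1 => [|c IH]; first by rewrite addn0.
  by rewrite addnS => sc; apply: IH; apply/step.
have neg j : s (Negz j) = 0.
  have step (i : nat) : s (Negz i) = 0 <-> s (Negz i.+1) = 0.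
    have := sM (Negz i.+1); have -> : Negz i.+1 + 1 = Negz i by lia.
    rewrite /= sdim0; last by move=> x; exact: thinmx0.
    lia.
  have : s (Negz (j + b.+1)) = 0 by apply: sb => /=; lia.
  elim: b.+1 => [|c IH]; first by rewrite addn0.
  by rewrite addnS => sc; apply: IH; apply/step.
by have := sM (Negz 0); rewrite /= neg pos addr0.
Qed.

End EulerForm.
(** * Generators and relations of C_n *)

Section ZigzagAlgebra.
Variables (k : fieldType) (n : nat) (hn : (2 <= n)%N).
Local Notation A := (C_algebra k hn).
Local Notation Q := (Cn_quiver hn).

Definition adj (v w : 'I_n) : bool := (v.+1 == w :> nat) || (w.+1 == v :> nat).

Lemma adj_sym v w : adj v w = adj w v.
Proof. by rewrite /adj orbC. Qed.

Definition cpi (x : path_algebra k Q) : A := quot_pi (@Cn_proper k n hn) x.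

Lemma cpiD x y : cpi (x + y) = cpi x + cpi y.
Proof. exact: quot_piD. Qed.

Lemma cpiM x y : cpi (x * y) = cpi x * cpi y.
Proof. exact/esym/quot_piM. Qed.

Lemma cpiZ c x : cpi (c *: x) = c *: cpi x.
Proof. exact/esym/quot_piZ. Qed.

Lemma cpi0 : cpi 0 = 0.
Proof. by apply: (addrI (cpi 0)); rewrite -cpiD !addr0. Qed.

Lemma cpi_rel x : Cn_relation x -> cpi x = 0.
Proof.
move=> r; rewrite -cpi0; apply/quot_piP; rewrite subr0.
by rewrite -[x]mulr1 -[x]mul1r; apply: tsi_gen.
Qed.

Definition ev (v : 'I_n) : A := cpi (pbasis k (@ptriv Q v)).

Lemma parrow_walk (a : arrow Q) : walk (src a) [:: a].
Proof. by rewrite /= eqxx. Qed.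

Definition parrow (a : arrow Q) : qpath Q :=
  @QPath Q (src a, [:: a]) (parrow_walk a).

Definition arr (a : arrow Q) : A := cpi (pbasis k (parrow a)).

Lemma cpi_path (p : qpath Q) a (e : ptgt p = src a) :
  cpi (pbasis k (@pcat Q p (parrow a) e)) = cpi (pbasis k p) * arr a.
Proof. by rewrite -cpiM pbasisM (@pmulE Q p (parrow a) e). Qed.

(** The value is 0 for non-adjacent vertices, so that sums may run over all pairs. *)
Definition ar (v w : 'I_n) : A :=
  oapp (fun a : arrow Q => arr a) 0 (insub (v, w)).

Definition mk_arrow v w (h : adj v w) : arrow Q := (Sub (v, w) h : Cn_arrow n).

Lemma ar_adj v w (h : adj v w) : ar v w = arr (mk_arrow h).
Proof. by rewrite /ar insubT. Qed.

Lemma ar_nadj v w : ~~ adj v w -> ar v w = 0.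
Proof. by move=> h; rewrite /ar insubN. Qed.

Lemma arr_ar (a : arrow Q) : arr a = ar (val a).1 (val a).2.
Proof.
have h := valP a; rewrite /= in h.
rewrite (@ar_adj (val a).1 (val a).2 h); congr arr; apply: val_inj => /=.
by case: (val a).
Qed.

Lemma ev_mul v w : ev v * ev w = (v == w)%:R *: ev v.
Proof.
rewrite -cpiM pbasisM pmul_trivl /=; case: eqVneq => [->|_] /=.
  by rewrite scale1r.
by rewrite scale0r cpi0.
Qed.

Lemma ev_idem v : ev v * ev v = ev v.
Proof. by rewrite ev_mul eqxx scale1r. Qed.

Lemma ev_sum : \sum_v ev v = 1.
Proof.
by rewrite -[1]/(cpi (pa_one k Q)) /pa_one (big_morph cpi cpiD cpi0).
Qed.

Lemma ev_arr v a : ev v * arr a = (v == src a)%:R *: arr a.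
Proof.
rewrite -cpiM pbasisM pmul_trivl /=; case: eqP => _ /=.
  by rewrite scale1r.
by rewrite scale0r cpi0.
Qed.

Lemma arr_ev v a : arr a * ev v = (v == tgt a)%:R *: arr a.
Proof.
rewrite -cpiM pbasisM pmul_trivr /=; case: eqP => _ /=.
  by rewrite scale1r.
by rewrite scale0r cpi0.
Qed.

Lemma ev_ar u v w : ev u * ar v w = (u == v)%:R *: ar v w.
Proof.
have [h|h] := boolP (adj v w); last by rewrite ar_nadj // mulr0 scaler0.
by rewrite (ar_adj h) ev_arr.
Qed.

Lemma ar_ev u v w : ar v w * ev u = (u == w)%:R *: ar v w.
Proof.
have [h|h] := boolP (adj v w); last by rewrite ar_nadj // mul0r scaler0.
by rewrite (ar_adj h) arr_ev.
Qed.

Lemma ar_mul0 v w w' u : w != w' -> ar v w * ar w' u = 0.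
Proof.
move=> ne; rewrite -[ar v w]scale1r -[1]/((true)%:R) -(eqxx w) -ar_ev -mulrA.
by rewrite ev_ar (negbTE ne) scale0r mulr0.
Qed.

Lemma ar_mulE v w u (h : adj v w) (h' : adj w u) :
  exists p : qpath Q, [/\ plength p = 2%N, psrc p = v, ptgt p = u &
    ar v w * ar w u = cpi (pbasis k p)].
Proof.
rewrite (ar_adj h) (ar_adj h').
set a := mk_arrow h; set b := mk_arrow h'.
have e : ptgt (parrow a) = src b by [].
exists (@pcat Q (parrow a) (parrow b) e); split=> //.
by rewrite cpi_path.
Qed.

Lemma ar_noncycle v w u : v != u -> ar v w * ar w u = 0.
Proof.
move=> ne; have [h|h] := boolP (adj v w); last by rewrite ar_nadj // mul0r.
have [h'|h'] := boolP (adj w u); last by rewrite [ar w u]ar_nadj // mulr0.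
have [p [p2 pv pu ->]] := ar_mulE h h'.
by apply/cpi_rel/Cn_noncycle => //; rewrite pv pu; apply/eqP.
Qed.

Lemma ar_cycle_end (v w : 'I_n) : (v == 0%N :> nat) || (v.+1 == n) ->
  ar v w * ar w v = 0.
Proof.
move=> hv; have [h|h] := boolP (adj v w); last by rewrite ar_nadj // mul0r.
have h' : adj w v by rewrite adj_sym.
have [p [p2 pv pu ->]] := ar_mulE h h'; apply: cpi_rel.
by case/orP: hv => /eqP e; [apply: Cn_first|apply: Cn_last];
  rewrite // ?pv ?pu.
Qed.

Lemma ar_cycle v w w' : adj v w -> adj v w' ->
  ar v w * ar w v = ar v w' * ar w' v.
Proof.
move=> h h1; have h' : adj w v by rewrite adj_sym.
have h1' : adj w' v by rewrite adj_sym.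
have [p [p2 pv pu ->]] := ar_mulE h h'.
have [q [q2 qv qu ->]] := ar_mulE h1 h1'.
apply/eqP; rewrite -subr_eq0 -scaleN1r -cpiZ -cpiD scaleN1r.
by apply/eqP/cpi_rel/Cn_cycles; rewrite // ?pv ?pu ?qv ?qu.
Qed.

(* Chosen so that the two cycles at a vertex get opposite signs: then [xx] below
   squares to zero, and this one equation encodes all the relations of C_n. *)
Definition sg (v w : 'I_n) : k := if (v < w)%N then 1 else (-1) ^+ v.

Lemma sg_sq v w : sg v w * sg v w = 1.
Proof.
rewrite /sg; case: ifP => _; first by rewrite mulr1.
by rewrite -expr2 sqrr_sign.
Qed.

Definition xx : A := \sum_v \sum_w sg v w *: ar v w.

Lemma ev_xx v : ev v * xx = \sum_w sg v w *: ar v w.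
Proof.
rewrite mulr_sumr (bigD1 v) //= mulr_sumr [X in _ + X]big1 ?addr0.
  by apply: eq_bigr => w _; rewrite -scalerAr ev_ar eqxx scale1r.
move=> u nu; rewrite mulr_sumr big1 // => w _.
by rewrite -scalerAr ev_ar eq_sym (negbTE nu) scale0r scaler0.
Qed.

Lemma ev_xx_ev v w : ev v * xx * ev w = sg v w *: ar v w.
Proof.
rewrite ev_xx mulr_suml (bigD1 w) //= -scalerAl ar_ev eqxx scale1r.
rewrite big1 ?addr0 // => u nu.
by rewrite -scalerAl ar_ev eq_sym (negbTE nu) scale0r scaler0.
Qed.

Lemma ev_xx_ev0 v w : ~~ adj v w -> ev v * xx * ev w = 0.
Proof. by move=> h; rewrite ev_xx_ev ar_nadj // scaler0. Qed.

Lemma ar_xx v w : ar v w * xx = (sg w v) *: (ar v w * ar w v).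
Proof.
rewrite mulr_sumr (bigD1 w) //= mulr_sumr [X in _ + X]big1 ?addr0; last first.
  move=> u nu; rewrite mulr_sumr big1 // => t _.
  by rewrite -scalerAr ar_mul0 ?scaler0 // eq_sym.
rewrite (bigD1 v) //= -scalerAr big1 ?addr0 // => u nu.
by rewrite -scalerAr ar_noncycle ?scaler0 // eq_sym.
Qed.

Lemma xx2 : xx * xx = 0.
Proof.
rewrite -[xx * xx]mul1r -ev_sum mulr_suml big1 // => v _.
rewrite mulrA ev_xx mulr_suml.
under eq_bigr do rewrite -scalerAl ar_xx scalerA.
have [ve|] := boolP ((v == 0%N :> nat) || (v.+1 == n)).
  by rewrite big1 // => w _; rewrite ar_cycle_end // scaler0.
rewrite negb_or => /andP[v0 vn].
have h1 : (v.+1 < n)%N by have := ltn_ord v; lia.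
have h2 : (v.-1 < n)%N by have := ltn_ord v; lia.
rewrite (bigD1 (Ordinal h1)) //= (bigD1 (Ordinal h2)) /=; last first.
  by rewrite -val_eqE /=; lia.
have a1 : adj v (Ordinal h1) by rewrite /adj /=; lia.
have a2 : adj v (Ordinal h2) by rewrite /adj /=; lia.
(* At an inner vertex the two cycles are equal in the algebra; the one through [v + 1] carries the
   sign (-1)^(v+1), the one through [v - 1] the sign (-1)^v. *)
rewrite (ar_cycle a1 a2) addrA -scalerDl big1 ?addr0; last first.
  move=> w /andP[w1 w2]; rewrite [ar v w]ar_nadj ?mul0r ?scaler0 //.
  by move: w1 w2; rewrite /adj -!val_eqE /=; lia.
have -> : sg v (Ordinal h1) * sg (Ordinal h1) v = (-1) ^+ v.+1.
  by rewrite /sg /= ltnSn ltnNge leqnSn /= mul1r.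
have -> : sg v (Ordinal h2) * sg (Ordinal h2) v = (-1) ^+ v.
  by rewrite /sg /= ltnNge leq_pred /= (_ : v.-1 < v)%N ?mulr1 //; lia.
by rewrite exprS mulN1r addNr scale0r.
Qed.

(** The idempotents and [xx] generate the algebra, because up to sign each arrow from [v] to [w] is
    [ev v * xx * ev w]. Compatibility of a linear map with the action thus needs checking on these
    elements only. *)
Lemma C_algebra_ind (P : A -> Prop) :
    (forall x y, P x -> P y -> P (x + y)) -> (forall c x, P x -> P (c *: x)) ->
    (forall x y, P x -> P y -> P (x * y)) -> (forall v, P (ev v)) -> P xx ->
  forall x, P x.
Proof.
move=> PD PZ PM Pe Px x; rewrite -(quot_piK x) -/(cpi _).
have Par a : P (arr a).
  rewrite arr_ar -[ar _ _]scale1r -(sg_sq (val a).1 (val a).2) -scalerA.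
  rewrite -ev_xx_ev.
  by apply/PZ/PM => //; apply: PM.
have P0 : P 0 by rewrite -(scale0r xx); apply: PZ.
elim/pa_ind: (repr x) => [|f g Pf Pg|c f Pf|[[v s] vs]].
- by rewrite cpi0.
- by rewrite cpiD; apply: PD.
- by rewrite cpiZ; apply: PZ.
elim/last_ind: s vs => [|s a IH] vs.
  by rewrite (_ : QPath vs = @ptriv Q v); [exact: Pe|exact: qpath_eq].
have /andP[ws /eqP e] : walk (Q := Q) v s && (src a == last v (map (@tgt Q) s)).
  by move: vs; rewrite /= -cats1 walk_cat /= andbT.
have -> : QPath vs = @pcat Q (@QPath Q (v, s) ws) (parrow a) (esym e).
  by apply: qpath_eq; rewrite //= /parrows /= cats1.
by rewrite cpi_path; apply: PM.
Qed.

End ZigzagAlgebra.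

(** * Modules over C_n from graded spaces with a square-zero operator *)

Section Representations.
Variables (k : fieldType) (n : nat) (hn : (2 <= n)%N).
Local Notation A := (C_algebra k hn).
Local Notation Q := (Cn_quiver hn).

(* A C_n-module is a vector space graded by the vertices, with an operator [zX]
   of square zero that maps each degree to the sum of its neighbours. *)
Record zigzag_rep := ZigzagRep {
  zspace : vectType k;
  zE : 'I_n -> zspace -> zspace;
  zX : zspace -> zspace;
  zE_lin : forall v, linear (zE v);
  zX_lin : linear zX;
  zE_id : forall v x, zE v (zE v x) = zE v x;
  zE_ne : forall v w x, v != w -> zE v (zE w x) = 0;
  zE_sum : forall x, \sum_v zE v x = x;
  zX_adj : forall v w x, ~~ adj v w -> zE w (zX (zE v x)) = 0;
  zX2 : forall x, zX (zX x) = 0 }.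

Variable R : zigzag_rep.
Local Notation V := (zspace R).
Local Notation E := (@zE R).
Local Notation X := (@zX R).
Implicit Types (p q : qpath Q) (f g : path_algebra k Q).

HB.instance Definition _ v := GRing.isLinear.Build k V V _ (E v) (@zE_lin R v).
HB.instance Definition _ := GRing.isLinear.Build k V V _ X (@zX_lin R).

Definition zXX (v w t : 'I_n) (x : V) : V := E t (X (E w (X (E v x)))).

(** Distinct vertices have at most one common neighbour, so this single term is the whole component
    of [X ^ 2] from degree [v] to degree [t]. *)
Lemma zXX_noncycle v w t x : v != t -> zXX v w t x = 0.
Proof.
move=> ne; rewrite /zXX.
have [h|h] := boolP (adj v w); last by rewrite (zX_adj _ h) !linear0.
have [h'|h'] := boolP (adj w t); last by rewrite (zX_adj _ h').
have := congr1 (E t) (zX2 (E v x)); rewrite linear0 -{1}[X (E v x)]zE_sum.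
rewrite !linear_sum /= (bigD1 w) //= big1 ?addr0 // => u nu.
have [g|g] := boolP (adj v u); last by rewrite (zX_adj _ g) !linear0.
have [g'|g'] := boolP (adj u t); last by rewrite (zX_adj _ g').
by move: ne nu h h' g g'; rewrite /adj -!val_eqE /=; lia.
Qed.

Lemma zXX_sum v x : \sum_u zXX v u v x = 0.
Proof.
have := congr1 (E v) (zX2 (E v x)); rewrite linear0 -{1}[X (E v x)]zE_sum.
by rewrite !linear_sum.
Qed.

Lemma zXX_nadj v w x : ~~ adj v w -> zXX v w v x = 0.
Proof. by move=> h; rewrite /zXX (zX_adj _ h) !linear0. Qed.

(** A vertex has at most two neighbours, so the component of [X ^ 2] from degree [v] to itself is
    the sum of these two cycles. *)
Lemma zXX_cycle v w w' x : adj v w -> adj v w' -> w != w' ->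
  zXX v w v x = - zXX v w' v x.
Proof.
move=> h h' ne; apply/eqP; rewrite -addr_eq0 -[0](zXX_sum v x).
rewrite (bigD1 w) //= (bigD1 w') 1?eq_sym //= addrA big1 ?addr0 // => u.
case/andP=> nu nu'; apply: zXX_nadj.
by move: ne nu nu' h h'; rewrite /adj -!val_eqE /=; lia.
Qed.

Lemma zXX_end v w x : (forall u, adj v u -> u = w) -> zXX v w v x = 0.
Proof.
move=> only; rewrite -[RHS](zXX_sum v x) (bigD1 w) //= big1 ?addr0 // => u nu.
by apply: zXX_nadj; apply: contra nu => /only->.
Qed.

(** Only the walk [v, w, v, w] needs an argument. If [v] has a second neighbour [w'], the first
    cycle may be rerouted through [w'] up to sign, and the last two steps then lead from [w'] to
    [w], which is not a cycle. Otherwise [v] is an end vertex and its cycle vanishes. *)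
Lemma zXXX v w t s x : E s (X (zXX v w t x)) = 0.
Proof.
have [e|ne] := eqVneq v t; last by rewrite zXX_noncycle // !linear0.
have [e'|ne'] := eqVneq w s; last first.
  by rewrite [LHS](zXX_noncycle t (X (E v x)) ne').
subst t s; have [h|h] := boolP (adj v w); last by rewrite zXX_nadj // !linear0.
case: (pickP (fun u => adj v u && (u != w))) => [w' /andP[h' ne]|none].
  rewrite (zXX_cycle x h h') 1?eq_sym // !linearN /=.
  by rewrite [E w _](zXX_noncycle v (X (E v x)) ne) oppr0.
rewrite (@zXX_end v w) ?linear0 // => u vu.
by apply/eqP; have := none u; rewrite vu /= => /negbFE.
Qed.

(** Compensates the minus sign in [zXX_cycle]: the two signed cycles act equally, as the relations
    of C_n demand. *)
Lemma sg_cycle (v w w' : 'I_n) : adj v w -> adj v w' -> w != w' ->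
  sg k v w * sg k w v = - (sg k v w' * sg k w' v).
Proof.
have up (a b : 'I_n) : (a.+1 = b)%N -> sg k a b * sg k b a = (-1) ^+ a.+1.
  by move=> e; rewrite /sg -e ltnSn ltnNge leqnSn mul1r.
have down (a b : 'I_n) : (b.+1 = a)%N -> sg k a b * sg k b a = (-1) ^+ a.
  by move=> e; rewrite mulrC (up _ _ e) e.
rewrite /adj -val_eqE => /orP[]/eqP e /orP[]/eqP e' ne.
- by case/eqP: ne; rewrite /= -e -e'.
- by rewrite (up _ _ e) (down _ _ e') exprS mulN1r.
- by rewrite (up _ _ e') (down _ _ e) exprS mulN1r opprK.
- by case/eqP: ne; rewrite /=; lia.
Qed.

(** The sign is its own inverse, so it cancels the sign of the arrow in [xx], and [xx] acts as
    [X]. *)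
Definition zstep (x : V) (a : arrow Q) : V :=
  sg k (src a) (tgt a) *: E (tgt a) (X x).

Definition zpath (p : qpath Q) (x : V) : V :=
  foldl zstep (E (psrc p) x) (parrows p).

Lemma zstep_lin a : linear (zstep^~ a).
Proof.
by move=> c x y; rewrite /zstep zX_lin zE_lin scalerDr !scalerA [c * _]mulrC.
Qed.

Lemma zpath_lin p : linear (zpath p).
Proof.
move=> c x y; rewrite /zpath zE_lin; move: (E _ x) (E _ y).
by elim: (parrows p) => //= a s IH x' y'; rewrite zstep_lin IH.
Qed.

HB.instance Definition _ p :=
  GRing.isLinear.Build k V V _ (zpath p) (zpath_lin p).

Lemma zpath_tgt p x : E (ptgt p) (zpath p x) = zpath p x.
Proof.
rewrite /zpath /ptgt.
have : E (psrc p) (E (psrc p) x) = E (psrc p) x by apply: zE_id.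
move: (psrc p) (E _ x); elim: (parrows p) => //= a s IH v y _; apply: IH.
by rewrite /zstep linearZ /= zE_id.
Qed.

Lemma zpath_cat p q (e : ptgt p = psrc q) x :
  zpath (pcat e) x = zpath q (zpath p x).
Proof.
by rewrite {2}/zpath -e zpath_tgt /zpath /parrows /= foldl_cat.
Qed.

Lemma zpath_ncat p q x : ptgt p <> psrc q -> zpath q (zpath p x) = 0.
Proof.
move=> ne; rewrite -[zpath p x]zpath_tgt /zpath zE_ne; last first.
  by apply/eqP => /esym.
by elim: (parrows q) => //= a s; rewrite /zstep !linear0.
Qed.

Lemma zpath2 p : plength p = 2%N -> exists w,
  [/\ adj (psrc p) w, adj w (ptgt p) & forall x,
    zpath p x =
      (sg k (psrc p) w * sg k w (ptgt p)) *: zXX (psrc p) w (ptgt p) x].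
Proof.
case: p => -[v [|a [|b []]]] //= p _; exists (tgt a).
have /and3P[/eqP av /eqP ba _] := p.
have ha := valP a; have hb := valP b.
split=> [||x].
- by rewrite /psrc /= -av.
- by have hb' : adj (val a).2 (val b).2 by rewrite -ba.
rewrite /zpath /psrc /parrows /ptgt /= /zstep.
rewrite -[src a]/(val a).1 av -[src b]/(val b).1 ba.
by rewrite !linearZ /= scalerA mulrC.
Qed.

Lemma zpath3 p x : plength p = 3%N -> zpath p x = 0.
Proof.
case: p => -[v [|a [|b [|c []]]]] //= p _.
rewrite /zpath /psrc /parrows /= /zstep !linearZ /=.
by rewrite -/(zXX v (tgt a) (tgt b) x) [E (tgt c) _]zXXX !scaler0.
Qed.

Definition zact (x : V) (f : path_algebra k Q) : V :=
  \sum_(p <- msupp f) f@_p *: zpath p x.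

Lemma zactEw (d : {fset qpath Q}) (f : path_algebra k Q) x :
    (msupp f `<=` d)%fset ->
  zact x f = \sum_(p <- d) f@_p *: zpath p x.
Proof.
move=> fd; rewrite /zact (big_fset_incl _ fd) // => p _ np.
by rewrite (mcoeff_outdom np) scale0r.
Qed.

Lemma zactD x f g : zact x (f + g) = zact x f + zact x g.
Proof.
set d := (msupp f `|` msupp g `|` msupp (f + g))%fset.
have s1 : (msupp f `<=` d)%fset by rewrite /d -fsetUA fsubsetUl.
have s2 : (msupp g `<=` d)%fset.
  by rewrite /d [(msupp f `|` _)%fset]fsetUC -fsetUA fsubsetUl.
have s3 : (msupp (f + g) `<=` d)%fset by rewrite /d fsubsetUr.
rewrite (zactEw x s1) (zactEw x s2) (zactEw x s3) -big_split /=.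
by apply: eq_bigr => p _; rewrite pa_coefD scalerDl.
Qed.

Lemma zactZ x c f : zact x (c *: f) = c *: zact x f.
Proof.
rewrite (zactEw x (msupp_paZ c f)) /zact scaler_sumr.
by apply: eq_bigr => p _; rewrite pa_coefZ scalerA.
Qed.

Lemma zact0 x : zact x 0 = 0.
Proof. by rewrite -(scale0r 0) zactZ scale0r. Qed.

Lemma zactb x p : zact x (pbasis k p) = zpath p x.
Proof. by rewrite /zact msupp_pbasis big_seq_fset1 pa_coefb eqxx scale1r. Qed.

Lemma zact_lin f : linear (zact^~ f).
Proof.
move=> c x y; rewrite /zact scaler_sumr -big_split /=.
by apply: eq_bigr => p _; rewrite linearP /= scalerDr !scalerA [c * _]mulrC.
Qed.

Lemma zact0l f : zact 0 f = 0.
Proof. exact: linear_at0 (@zact_lin f). Qed.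

Lemma zactDl x y f : zact (x + y) f = zact x f + zact y f.
Proof. by have := zact_lin f 1 x y; rewrite !scale1r. Qed.

Lemma zactZl c x f : zact (c *: x) f = c *: zact x f.
Proof. by have := zact_lin f c x 0; rewrite zact0l !addr0. Qed.

Lemma zactM x f g : zact x (f * g) = zact (zact x f) g.
Proof.
elim/pa_ind: f => [|f f' Ef Ef'|c f Ef|p].
- by rewrite mul0r zact0 zact0l.
- by rewrite mulrDl !zactD Ef Ef' zactDl.
- by rewrite -scalerAl !zactZ Ef zactZl.
elim/pa_ind: g => [|g g' Eg Eg'|c g Eg|q].
- by rewrite mulr0 !zact0.
- by rewrite mulrDr !zactD Eg Eg'.
- by rewrite -scalerAr !zactZ Eg.
rewrite pbasisM !zactb; case: (ptgt p =P psrc q) => [e|ne].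
  by rewrite (pmulE e) /= zactb zpath_cat.
by rewrite pmulN //= zact0 zpath_ncat.
Qed.

Lemma zact_rel x f : Cn_relation f -> zact x f = 0.
Proof.
case=> [p p3|p p2 ne|p q p2 q2 ep eq epq|p p2 ep e|p p2 ep e].
- by rewrite zactb zpath3.
- rewrite zactb; have [w [_ _ ->]] := zpath2 p2.
  by rewrite zXX_noncycle ?scaler0 //; apply/eqP.
- rewrite -scaleN1r zactD zactZ scaleN1r !zactb.
  have [w [h _ ->]] := zpath2 p2; have [w' [h' _ ->]] := zpath2 q2.
  rewrite -eq -ep -epq; rewrite -epq in h'; apply/eqP; rewrite subr_eq0.
  have [->//|ne] := eqVneq w w'.
  by rewrite (zXX_cycle x h h' ne) (sg_cycle h h' ne) scalerN scaleNr opprK.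
- rewrite zactb; have [w [h _ ->]] := zpath2 p2.
  rewrite -ep zXX_end ?scaler0 // => u hu; apply: val_inj.
  by move: h hu; rewrite /adj /=; have := ltn_ord w; have := ltn_ord u; lia.
rewrite zactb; have [w [h _ ->]] := zpath2 p2.
rewrite -ep zXX_end ?scaler0 // => u hu; apply: val_inj.
by move: h hu; rewrite /adj /=; lia.
Qed.

Lemma zact_ideal x f : two_sided_ideal (@Cn_relation k n hn) f -> zact x f = 0.
Proof.
elim=> [|f1 f2 _ E1 _ E2|f1 s f2 r]; first exact: zact0.
  by rewrite zactD E1 E2 addr0.
by rewrite !zactM (zact_rel _ r) zact0l.
Qed.

(** As the ideal acts by zero, the choice of a representative in the definition of [zmod] is
    harmless. *)
Lemma zact_pi x f : zact x (repr (cpi f : A)) = zact x f.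
Proof.
have : two_sided_ideal (@Cn_relation k n hn) (repr (cpi f : A) - f).
  by apply/(quot_piP (@Cn_proper k n hn)); exact: quot_piK.
move=> /(zact_ideal x) /eqP; rewrite -scaleN1r zactD zactZ scaleN1r subr_eq0.
by move/eqP.
Qed.

Lemma zact_one x : zact x 1 = x.
Proof.
rewrite -[1]/(pa_one k Q) /pa_one (big_morph _ (zactD x) (zact0 x)).
rewrite -[RHS]zE_sum; apply: eq_bigr => v _; by rewrite zactb.
Qed.

Program Definition zmod : rmodule A :=
  @RModule k A V (fun x a => zact x (repr a)) _ _ _ _.
Next Obligation. by move=> a; exact: zact_lin. Qed.
Next Obligation.
move=> x c a b; rewrite -(quot_piK a) -(quot_piK b) -!/(cpi _).
by rewrite -cpiZ -cpiD !zact_pi zactD zactZ.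
Qed.
Next Obligation. by move=> x; exact: etrans (zact_pi x 1) (zact_one x). Qed.
Next Obligation.
move=> x a b; rewrite -(quot_piK a) -(quot_piK b) -!/(cpi _) -cpiM.
by rewrite !zact_pi zactM.
Qed.

Lemma zmod_ev (x : zmod) v : ract x (ev k hn v) = E v x.
Proof. by rewrite /= zact_pi zactb. Qed.

Lemma zmod_xx (x : zmod) : ract x (xx k hn) = X x.
Proof.
rewrite /xx ractr_sum -[X x]zE_sum.
under eq_bigr do rewrite ractr_sum.
rewrite exchange_big; apply: eq_bigr => w _.
rewrite -{2}[x]zE_sum !linear_sum; apply: eq_bigr => v _; rewrite [RHS]/=.
have [h|h] := boolP (adj v w); last first.
  rewrite (zX_adj _ h) ar_nadj // scaler0; exact: (@ractr0 k A zmod x).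
rewrite (ar_adj k hn h) (@ractZr k A zmod) /= zact_pi zactb /zpath /= /zstep.
by rewrite scalerA sg_sq scale1r.
Qed.

End Representations.
(** * Projective modules and their deformations *)

Section Projectives.
Variables (k : fieldType) (n : nat) (hn : (2 <= n)%N).
Local Notation A := (C_algebra k hn).
Local Notation ev := (ev k hn).
Local Notation xx := (xx k hn).

Lemma C_rhom (M N : rmodule A) (f : M -> N) : linear f ->
    (forall x v, f (ract x (ev v)) = ract (f x) (ev v)) ->
    (forall x, f (ract x xx) = ract (f x) xx) ->
  exists h : rhom M N, forall x, h x = f x.
Proof.
move=> fl fe fx.
pose flin := GRing.isLinear.Build k M N _ f fl.
pose F : {linear M -> N} := HB.pack f flin.
suff fa x a : f (ract x a) = ract (f x) a by exists (RHom fl fa).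
elim/C_algebra_ind: a x => [a b Ea Eb|c a Ea|a b Ea Eb|v|] x.
- by rewrite !ractDr -Ea -Eb; exact: (linearD F).
- by rewrite !ractZr -Ea; exact: (linearZ_LR F).
- by rewrite !ractM Eb Ea.
- exact: fe.
- exact: fx.
Qed.

(* [M] lifts to the first-order deformation [xx ^ 2 = t] of the algebra, with
   [xx + t Y] acting on [M[t]/t^2]. *)
Definition deformable (M : rmodule A) : Prop := exists Y : M -> M,
  [/\ linear Y,
      forall v w x, ~~ adj v w -> ract (Y (ract x (ev v))) (ev w) = 0
    & forall x, ract (Y x) xx + Y (ract x xx) = x].

Lemma ract_ev M (x : rcarrier M) (v w : 'I_n) : ract x (ev v) = x ->
  ract x (ev w) = (w == v)%:R *: x :> (M : rmodule A).
Proof.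
by move=> xv; rewrite -{1}xv -ractM ev_mul ractZr eq_sym xv.
Qed.

Lemma ev_xx_sum v : ev v * xx = \sum_w ev v * xx * ev w.
Proof. by rewrite -mulr_sumr ev_sum mulr1. Qed.

Lemma ev_xx_end v w : (forall u, adj v u -> u = w) ->
  ev v * xx = ev v * xx * ev w.
Proof.
move=> only; rewrite {1}ev_xx_sum (bigD1 w) //= big1 ?addr0 // => u nu.
by apply: ev_xx_ev0; apply: contraNN nu => /only ->.
Qed.

Lemma ev_xx_mid v w w' : w != w' -> (forall u, adj v u -> u = w \/ u = w') ->
  ev v * xx = ev v * xx * ev w + ev v * xx * ev w'.
Proof.
move=> ne only; rewrite {1}ev_xx_sum (bigD1 w) //= (bigD1 w') 1?eq_sym //=.
rewrite addrA big1 ?addr0 // => u /andP[nu nu'].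
apply: ev_xx_ev0; apply/negP => /only[] e; [move: nu|move: nu'];
  by rewrite e eqxx.
Qed.

Lemma ev_cycle_ev v w u :
  ev v * xx * ev w * xx * ev u = (u == v)%:R *: (ev v * xx * ev w * xx).
Proof.
rewrite ev_xx_ev -!scalerAl ar_xx -!scalerAl -mulrA ar_ev -scalerAr !scalerA.
by congr (_ *: _); rewrite mulrC mulrA.
Qed.

Lemma delta_id (u v : 'I_n) (c : k) :
  (u == v)%:R * ((u == v)%:R * c) = (u == v)%:R * c.
Proof. by rewrite mulrA -natrM mulnb andbb. Qed.

Lemma delta_ne (u u' v : 'I_n) (c : k) : u != u' ->
  (u == v)%:R * ((u' == v)%:R * c) = 0.
Proof.
move=> ne; case: (u =P v) ne => [->|_] ne; rewrite ?mul0r //.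
by rewrite eq_sym (negbTE ne) mul0r mulr0.
Qed.

Lemma delta_sum (v : 'I_n) (c : k) : \sum_u (u == v)%:R * c = c.
Proof.
rewrite (bigD1 v) //= eqxx mul1r big1 ?addr0 // => u /negbTE->.
by rewrite mul0r.
Qed.

Lemma delta_adj (v w a b : 'I_n) (c : k) : adj a b -> ~~ adj v w ->
  (w == b)%:R * ((v == a)%:R * c) = 0.
Proof.
move=> h; case: (w =P b) => [->|_] nadj; last by rewrite mul0r.
case: (v =P a) nadj => [->|_]; first by rewrite h.
by rewrite mul0r mulr0.
Qed.

Lemma scale_one (c : k) : c *: (1 : k^o) = c.
Proof. exact: mulr1. Qed.

Lemma pair_sum (U V : zmodType) (I : Type) (r : seq I) (F : I -> U) (G : I -> V) :
  \sum_(i <- r) (F i, G i) = (\sum_(i <- r) F i, \sum_(i <- r) G i).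
Proof. by elim: r => [|i r IH]; rewrite ?big_nil // !big_cons IH. Qed.

Section EndVertex.
Variables (v w : 'I_n) (vw : adj v w) (only : forall u, adj v u -> u = w).

(** The projective at an end vertex: the coordinates belong to the generator at [v] and to its image
    under [xx] at [w]. *)
Program Definition end_rep : zigzag_rep k n :=
  @ZigzagRep k n (k^o * k^o)%type
    (fun u z => ((u == v)%:R * z.1, (u == w)%:R * z.2))
    (fun z => (0, z.1)) _ _ _ _ _ _ _.
Next Obligation.
by move=> u c [a p] [a' p']; congr (_, _); rewrite /= mulrDr mulrCA.
Qed.
Next Obligation.
by move=> c [a p] [a' p']; congr (_, _); rewrite /= ?scaler0 ?addr0.
Qed.
Next Obligation. by move=> u [a p]; rewrite /= !delta_id. Qed.
Next Obligation. by move=> u u' [a p] ne; rewrite /= !delta_ne. Qed.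
Next Obligation. by move=> [a p]; rewrite pair_sum !delta_sum. Qed.
Next Obligation.
by move=> u u' [a p] nadj; rewrite /= mulr0 (delta_adj _ vw).
Qed.
Next Obligation. by move=> [a p]. Qed.

Definition end_proj : rmodule A := zmod hn end_rep.
Definition end_gen : end_proj := (1, 0).

Lemma end_gen_ev : ract end_gen (ev v) = end_gen.
Proof. by rewrite zmod_ev /= eqxx mulr1 mulr0. Qed.

Lemma end_proj_ext (X : rmodule A) (x : X) :
  ract x (ev v) = x -> exists h : rhom end_proj X, h end_gen = x.
Proof.
move=> xv.
pose y := ract x (ev v * xx * ev w).
have xxE : ract x xx = y by rewrite -{1}xv -ractM (ev_xx_end only).
have yxx : ract y xx = 0 by rewrite -xxE -ractM xx2 ractr0.
have [|z u|z|h hE] := @C_rhom end_proj X (fun z => z.1 *: x + z.2 *: y).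
- move=> c [a p] [a' p'] /=.
  by rewrite !scalerDl scalerDr !scalerA addrACA.
- rewrite zmod_ev ractD !ractZ (ract_ev u xv) /=.
  rewrite (ract_ev (v := w) u) ?scalerA; last first.
    by rewrite /y -ractM -!mulrA ev_idem.
  by rewrite ![_ * z.1]mulrC ![_ * z.2]mulrC.
- by rewrite zmod_xx ractD !ractZ xxE yxx scaler0 addr0 /= scale0r add0r.
by exists h; rewrite hE /= scale1r scale0r addr0.
Qed.

Lemma end_proj_projective : projective end_proj.
Proof.
apply: (projective_cyclic (e := end_gen) (u := ev v)).
- exact: ev_idem.
- exact: end_gen_ev.
- move=> [a p]; exists (a *: 1 + p *: xx).
  rewrite ractDr !ractZr ract1 zmod_xx /=.
  by congr (_, _); rewrite /= scaler0 scale_one ?addr0 ?add0r.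
exact: end_proj_ext.
Qed.

Lemma end_proj_deformable : deformable end_proj.
Proof.
(* The witness reverses [xx], sending the basis vector at [w] back to the generator. *)
exists (fun z => (z.2, 0)); split=> [c [a p] [a' p']|u u' z nadj|z].
- by congr (_, _); rewrite /= scaler0 addr0.
- rewrite !zmod_ev /= mulr0 (delta_adj (a := w) (b := v)) //.
  by rewrite adj_sym.
rewrite !zmod_xx /=; case: z => a p.
by congr (_, _); rewrite /= ?addr0 ?add0r.
Qed.

End EndVertex.

Section MiddleVertex.
Variables (v w w' : 'I_n) (vw : adj v w) (vw' : adj v w') (ne : w != w').
Hypothesis only : forall u, adj v u -> u = w \/ u = w'.

(** The projective at an inner vertex: the coordinates belong to the generator at [v], its images at
    [w] and [w'], and the socle at [v]. The socle is reached from [w] and [w'] with opposite signs,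
    which makes the operator square to zero. *)
Program Definition mid_rep : zigzag_rep k n :=
  @ZigzagRep k n ((k^o * k^o) * (k^o * k^o))%type
    (fun u z => (((u == v)%:R * z.1.1, (u == w)%:R * z.1.2),
                 ((u == w')%:R * z.2.1, (u == v)%:R * z.2.2)))
    (fun z => ((0, z.1.1), (z.1.1, z.1.2 - z.2.1))) _ _ _ _ _ _ _.
Next Obligation.
by move=> u c [[a p] [q s]] [[a' p'] [q' s']]; congr ((_, _), (_, _));
  rewrite /= mulrDr mulrCA.
Qed.
Next Obligation.
move=> c [[a p] [q s]] [[a' p'] [q' s']]; congr ((_, _), (_, _)) => /=.
  by rewrite scaler0 addr0.
by rewrite scalerBr opprD addrACA.
Qed.
Next Obligation. by move=> u [[a p] [q s]]; rewrite /= !delta_id. Qed.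
Next Obligation. by move=> u u' [[a p] [q s]] nu; rewrite /= !delta_ne. Qed.
Next Obligation.
by move=> [[a p] [q s]]; rewrite !pair_sum !delta_sum.
Qed.
Next Obligation.
move=> u u' [[a p] [q s]] nadj; rewrite /= mulr0 (delta_adj _ vw) //.
rewrite (delta_adj _ vw') // mulrBr !(delta_adj (b := v)) ?subr0 // adj_sym //.
Qed.
Next Obligation. by move=> [[a p] [q s]]; rewrite /= subrr. Qed.

Definition mid_proj : rmodule A := zmod hn mid_rep.
Definition mid_gen : mid_proj := ((1, 0), (0, 0)).

Lemma mid_gen_ev : ract mid_gen (ev v) = mid_gen.
Proof. by rewrite zmod_ev /= eqxx mulr1 !mulr0. Qed.

Lemma mid_proj_ext (X : rmodule A) (x : X) :
  ract x (ev v) = x -> exists h : rhom mid_proj X, h mid_gen = x.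
Proof.
move=> xv.
pose y := ract x (ev v * xx * ev w); pose y' := ract x (ev v * xx * ev w').
pose t := ract x (ev v * xx * ev w * xx).
have xxE : ract x xx = y + y'.
  by rewrite -{1}xv -ractM (ev_xx_mid ne only) ractDr.
have yxx : ract y xx = t by rewrite -ractM.
have y'xx : ract y' xx = - t.
  apply/eqP; rewrite -addr_eq0 -yxx addrC -ractD -xxE -ractM xx2.
  by rewrite ractr0.
have [|z u|z|h hE] := @C_rhom mid_proj X
    (fun z => z.1.1 *: x + z.1.2 *: y + z.2.1 *: y' + z.2.2 *: t).
- move=> c [[a p] [q s]] [[a' p'] [q' s']] /=.
  rewrite !scalerDl !scalerDr !scalerA.
  rewrite [RHS]addrACA; congr (_ + _).
  by rewrite [RHS]addrACA; congr (_ + _); rewrite addrACA.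
- rewrite zmod_ev !ractD !ractZ (ract_ev u xv) /=.
  rewrite (ract_ev (v := w) u); last by rewrite /y -ractM -!mulrA ev_idem.
  rewrite (ract_ev (v := w') u); last by rewrite /y' -ractM -!mulrA ev_idem.
  rewrite -[ract t _]ractM ev_cycle_ev ractZr -/t !scalerA.
  by rewrite ![_ * z.1.1]mulrC ![_ * z.2.1]mulrC ![_ * z.1.2]mulrC
    ![_ * z.2.2]mulrC.
- rewrite zmod_xx !ractD !ractZ xxE yxx y'xx -[ract t _]ractM -mulrA xx2.
  rewrite mulr0 ractr0.
  rewrite /= scale0r add0r scaler0 addr0 scalerDr scalerBl scalerN.
  by rewrite !addrA.
by exists h; rewrite hE /= scale1r !scale0r !addr0.
Qed.

Lemma mid_proj_projective : projective mid_proj.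
Proof.
apply: (projective_cyclic (e := mid_gen) (u := ev v)).
- exact: ev_idem.
- exact: mid_gen_ev.
- move=> [[a p] [q s]].
  exists (a *: 1 + p *: (xx * ev w) + q *: (xx * ev w')
    + s *: (xx * ev w * xx)).
  rewrite !ractDr !ractZr ract1 !ractM !zmod_xx !zmod_ev /=.
  rewrite !eqxx [w' == w]eq_sym (negbTE ne).
  by congr ((_, _), (_, _)); rewrite /= ?(mul0r, mulr0, mul1r, mulr1, subr0)
    ?scale_one ?scaler0 ?(addr0, add0r).
exact: mid_proj_ext.
Qed.

Lemma mid_proj_deformable : deformable mid_proj.
Proof.
(* The vector at [w] goes to the generator and the socle vector to minus the vector at [w']. Up to
   sign, [w] and [w'] could be exchanged here. *)
exists (fun z => ((z.1.2, 0), (- z.2.2, 0))).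
split=> [c [[a p] [q s]] [[a' p'] [q' s']]|u u' z nadj|z].
- by congr ((_, _), (_, _)); rewrite /= ?scaler0 ?addr0 // scalerN opprD.
- rewrite !zmod_ev /= !mulr0 mulrN !(delta_adj _ _ nadj) ?oppr0 //.
  by rewrite adj_sym.
rewrite !zmod_xx /=; case: z => [[a p] [q s]].
congr ((_, _), (_, _)); rewrite /= ?addr0 ?add0r //.
  by rewrite opprB addrCA subrr addr0.
by rewrite opprK.
Qed.

End MiddleVertex.

(** * Covers and resolutions by deformable projectives *)

Lemma vertex_proj v : exists (P : rmodule A) (g : P),
  [/\ projective P, deformable P & forall (X : rmodule A) (x : X),
    ract x (ev v) = x -> exists h : rhom P X, h g = x].
Proof.
have use_end w (vw : adj v w) (only : forall u, adj v u -> u = w) :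
    exists (P : rmodule A) (g : P),
      [/\ projective P, deformable P & forall (X : rmodule A) (x : X),
        ract x (ev v) = x -> exists h : rhom P X, h g = x].
  exists (end_proj vw), (end_gen vw); split.
  - exact: end_proj_projective.
  - exact: end_proj_deformable.
  - exact: end_proj_ext.
have [v0|v0] := eqVneq (v : nat) 0%N.
  apply: (use_end (Ordinal hn)); first by rewrite /adj v0.
  by move=> u; rewrite /adj => vu; apply: val_inj => /=; lia.
have h' : (v.-1 < n)%N by have := ltn_ord v; lia.
have a' : adj v (Ordinal h') by rewrite /adj /=; lia.
have [vn|vn] := eqVneq v.+1 n.
  apply: (use_end (Ordinal h')) => // u; rewrite /adj => vu.
  by apply: val_inj => /=; have := ltn_ord u; lia.
have h : (v.+1 < n)%N by have := ltn_ord v; lia.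
have a : adj v (Ordinal h) by rewrite /adj /= eqxx.
have ne : Ordinal h != Ordinal h' by rewrite -val_eqE /=; lia.
have only u : adj v u -> u = Ordinal h \/ u = Ordinal h'.
  by case/orP=> /eqP e; [left|right]; apply: val_inj => /=; lia.
exists (mid_proj a a'), (mid_gen a a'); split.
- exact: mid_proj_projective.
- exact: mid_proj_deformable.
- exact: mid_proj_ext.
Qed.

Lemma deformable0 : deformable (rmod0 A).
Proof.
exists id; split=> [c x y|v w x _|x] //; first exact: thinmx0.
by rewrite [LHS]thinmx0 [RHS]thinmx0.
Qed.

Lemma deformable_prod (P P' : rmodule A) :
  deformable P -> deformable P' -> deformable (rprod P P').
Proof.
move=> [Y [Yl Ya Yx]] [Y' [Yl' Ya' Yx']].
exists (fun z => (Y z.1, Y' z.2)); split=> [c x y|v w x vw|[x y]].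
- by congr (_, _); [apply: Yl|apply: Yl'].
- by rewrite /= Ya // Ya'.
- by congr (_, _); [apply: Yx|apply: Yx'].
Qed.

(** Each pair [(v, x)] contributes one vertex projective as a direct summand, its generator being
    sent to [x * ev v]. *)
Lemma cover_seq (M : rmodule A) (s : seq ('I_n * M)) :
  exists (P : rmodule A) (f : rhom P M), [/\ projective P, deformable P &
    forall y, y \in s -> exists z, f z = ract y.2 (ev y.1)].
Proof.
elim: s => [|[v x] s [P [f [pP dP fs]]]].
  exists (rmod0 A), (rhom0 _ M); split=> //; first exact: projective0.
  exact: deformable0.
have [P' [g [pP' dP' ext]]] := vertex_proj v.
have [h hg] := ext M (ract x (ev v)) ltac:(by rewrite -ractM ev_idem).
exists (rprod P' P), (rhom_copair h f); split.
- exact: projective_prod.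
- exact: deformable_prod.
move=> y; rewrite inE => /orP[/eqP->|/fs[z fz]].
  by exists (g, 0); rewrite /= linear0 addr0.
by exists (0, z); rewrite /= linear0 add0r.
Qed.

Lemma cover (M : rmodule A) : exists (P : rmodule A) (f : rhom P M),
  [/\ projective P, deformable P & forall y, exists z, f z = y].
Proof.
have [P [f [pP dP fs]]] :=
  cover_seq [seq (v, x) | v <- enum 'I_n, x <- vbasis (fullv : {vspace M})].
exists P, f; split=> //.
have surj y : y \in limg (linfun f) -> exists z, f z = y.
  by move=> /memv_imgP[z _ ->]; exists z; rewrite lfunE.
move=> y; apply: surj.
suff /subvP : ((fullv : {vspace M}) <= limg (linfun f))%VS.
  by apply; rewrite memvf.
rewrite -(span_basis (vbasisP fullv)); apply/span_subvP => x xb.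
(* The idempotents sum to 1, so a basis vector is the sum of its components, each of which was
   covered. *)
rewrite -[x]ract1 -ev_sum ractr_sum memv_suml // => v _.
have [|z fz] := fs (v, x); first by apply: allpairs_f; rewrite ?mem_enum.
by rewrite -[ract _ _]fz -[f z](lfunE f) memv_img ?memvf.
Qed.

Lemma deformable_resolution (M : rmodule A) :
  exists R : proj_resolution M, deformable (pr_obj R 0).
Proof.
pose cov N := projT1 (cid (cover N)).
pose f N : rhom (cov N) N := projT1 (cid (projT2 (cid (cover N)))).
have fP N : [/\ projective (cov N), deformable (cov N)
    & forall y, exists z, f N z = y].
  exact: (projT2 (cid (projT2 (cid (cover N))))).
have pP N : projective (cov N) by have [] := fP N.
have fS N : forall y, exists z, f N z = y by have [] := fP N.
exists (cov_resolution pP fS M); by have [_ ? _] := fP M.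
Qed.

(** * Extensions twisted by a map that anticommutes with [xx] *)

Section TwistedExtension.
Variables (P M : rmodule A) (phi : P -> M).
Hypotheses (phi_lin : linear phi)
  (phi_ev : forall v w x, ~~ adj v w -> ract (phi (ract x (ev v))) (ev w) = 0)
  (phi_xx : forall x, phi (ract x xx) = - ract (phi x) xx).

(** An extension of [P] by [M] with [phi] as the off-diagonal entry of [xx]. That [phi] anticommutes
    with [xx] is exactly what makes the new operator square to zero. *)
Program Definition twisted_rep : zigzag_rep k n :=
  @ZigzagRep k n (P * M)%type
    (fun v z => (ract z.1 (ev v), ract z.2 (ev v)))
    (fun z => (ract z.1 xx, ract z.2 xx + phi z.1)) _ _ _ _ _ _ _.
Next Obligation. by move=> v c x y; congr (_, _); apply: ract_linl. Qed.
Next Obligation.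
move=> c x y; congr (_, _); rewrite /= ract_linl // phi_lin scalerDr.
by rewrite addrACA.
Qed.
Next Obligation. by move=> v x; rewrite /= -!ractM ev_idem. Qed.
Next Obligation.
by move=> v w x /negbTE ne; rewrite /= -!ractM ev_mul eq_sym ne scale0r !ractr0.
Qed.
Next Obligation.
by move=> [x y]; rewrite pair_sum -!ractr_sum ev_sum !ract1.
Qed.
Next Obligation.
move=> v w x nadj; rewrite /= ractD phi_ev // addr0 -!ractM mulrA.
by rewrite ev_xx_ev0 // !ractr0.
Qed.
Next Obligation.
by move=> x; rewrite /= ractD phi_xx -!ractM xx2 !ractr0 add0r subrr.
Qed.

(** Projectivity splits the extension, and [delta] is the component in [M] of a section; it exhibits
    [phi] as a commutator with [xx]. *)
Lemma twisted_split : projective P -> exists delta : P -> M,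
  [/\ linear delta, forall x v, delta (ract x (ev v)) = ract (delta x) (ev v)
    & forall x, delta (ract x xx) = ract (delta x) xx + phi x].
Proof.
pose E := zmod hn twisted_rep.
have [//|x v|x|p pE] := @C_rhom E P (fun z => z.1).
- by rewrite zmod_ev.
- by rewrite zmod_xx.
move=> pP; have [y|h hE] := pP E P p (rhom_id P); first by exists (y, 0).
have h1 x : (h x).1 = x by rewrite -pE hE.
exists (fun x => (h x).2); split=> [c x y|x v|x].
- by rewrite linearP.
- by rewrite rhom_act zmod_ev.
- by rewrite rhom_act zmod_xx /= h1.
Qed.

End TwistedExtension.

(* If Ext^2(M, M) = 0, then M deforms along [xx ^ 2 = t] to first order: the
   operator becomes [xx + t y], so [y xx + xx y = 1] and [xx] is exact on M.
   Only this exactness is extracted here. *)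
Lemma Ext2_exact (M : rmodule A) : Ext_zero 2 M M ->
  forall m : M, ract m xx = 0 -> exists m', m = ract m' xx.
Proof.
move=> ext; have [R [Y [Yl Ya Yx]]] := deformable_resolution M.
have := ext R; rewrite /Hom_cohomology_zero => exact2.
set P1 := pr_obj R 1; set d : rhom P1 _ := pr_d R 0; set aug := pr_aug R.
have augd q : aug (d q) = 0 by apply/(pr_exact0 (p := R)); exists q.
have dd q : d (pr_d R 1 q) = 0 by apply/(pr_exactS (p := R)); exists q.
(* Since [Y xx + xx Y = 1] and [aug d = 0], this map anticommutes with [xx] and so defines a twisted
   extension of [P1] by [M]. *)
pose phi (q : P1) : M := aug (Y (d q)).
have phi_lin : linear phi by move=> c x y; rewrite /phi linearP Yl linearP.
have phi_xx q : phi (ract q xx) = - ract (phi q) xx.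
  apply/eqP; rewrite -addr_eq0 /phi -rhom_act -linearD /= rhom_act.
  by rewrite addrC Yx augd.
have phi_ev v w q : ~~ adj v w -> ract (phi (ract q (ev v))) (ev w) = 0.
  by move=> vw; rewrite /phi -rhom_act [d _]rhom_act Ya ?linear0.
have [delta [dl dv dx]] :=
  twisted_split phi_lin phi_ev phi_xx (@pr_proj _ _ _ R 1).
(* The defect of [delta] from being a homomorphism is [phi], which vanishes on boundaries. Hence
   [delta] after the differential is a homomorphism, indeed a 2-cocycle: it represents the
   obstruction in Ext^2(M, M). *)
have [|q v|q|h hE] := @C_rhom (pr_obj R 2) M (fun q => delta (pr_d R 1 q)).
- by move=> c x y; rewrite linearP dl.
- by rewrite rhom_act dv.
- by rewrite rhom_act dx /phi dd (linear_at0 Yl) linear0 addr0.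
have [q|g gE] := exact2 h.
  rewrite hE (_ : pr_d R 1 _ = 0) ?(linear_at0 dl) //.
  by apply/(pr_exactS (p := R)); exists q.
move=> m mx; have [p pm] := pr_aug_surj R m.
have [q dq] : exists q, d q = ract p xx.
  by apply/(pr_exact0 (p := R)); rewrite rhom_act -/aug pm.
have [q2 dq2] : exists q2, pr_d R 1 q2 = ract q xx.
  apply/(pr_exactS (p := R)); rewrite -/d rhom_act dq -ractM xx2.
  exact: ractr0.
(* The first term alone satisfies [aug (Y p) xx = m - phi q]. As [g - delta] vanishes on the
   boundary [q xx], the second term contributes exactly the missing [phi q]. *)
exists (aug (Y p) + (g q - delta q)).
have phiq : phi q = ract (g q - delta q) xx.
  rewrite ractD ractN -rhom_act -dq2 -gE hE dq2 dx.
  by rewrite addrC addKr.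
by rewrite ractD -phiq /phi dq -rhom_act -linearD /= Yx pm.
Qed.

End Projectives.
(** * Even and odd vertices *)

Section Parity.
Variables (k : fieldType) (n : nat) (hn : (2 <= n)%N).
Local Notation A := (C_algebra k hn).
Local Notation ev := (ev k hn).
Local Notation xx := (xx k hn).

Definition parity_idem (b : bool) : A := \sum_(v : 'I_n | odd v == b) ev v.

Lemma ev_parity v b : ev v * parity_idem b = (odd v == b)%:R *: ev v.
Proof.
rewrite /parity_idem mulr_sumr big_mkcond (bigD1 v) //= big1 ?addr0.
  by rewrite ev_idem; case: eqP => _; rewrite ?scale1r ?scale0r.
by move=> u nu; rewrite ev_mul [v == u]eq_sym (negbTE nu) scale0r if_same.
Qed.

Lemma parity_idemP b : parity_idem b * parity_idem b = parity_idem b.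
Proof.
rewrite {1}/parity_idem mulr_suml; apply: eq_bigr => v /eqP vb.
by rewrite ev_parity vb eqxx scale1r.
Qed.

(** Adjacent vertices have opposite parity. *)
Lemma xx_parity b : xx * parity_idem b = parity_idem (~~ b) * xx.
Proof.
rewrite /xx mulr_suml mulr_sumr; apply: eq_bigr => v _.
rewrite mulr_suml mulr_sumr; apply: eq_bigr => w _.
rewrite -scalerAl -scalerAr; congr (_ *: _).
have [h|h] := boolP (adj v w); last by rewrite ar_nadj // mul0r mulr0.
have odd_vw : (odd v == ~~ b) = (odd w == b).
  by case/orP: h => /eqP <-; rewrite /= ?(inj_eq negb_inj) //; case: odd; case: b.
transitivity ((odd w == b)%:R *: ar k hn v w).
  rewrite -[ar k hn v w in LHS]scale1r -[1]/(true%:R) -(eqxx w) -ar_ev -mulrA.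
  by rewrite ev_parity -scalerAr ar_ev eqxx scale1r.
rewrite /parity_idem mulr_suml big_mkcond (bigD1 v) //= big1 ?addr0.
  by rewrite ev_ar eqxx odd_vw; case: eqP => _; rewrite ?scale1r ?scale0r.
by move=> u nu; rewrite ev_ar (negbTE nu) scale0r if_same.
Qed.

(** The kernel of [xx] on one parity is the image of the other, so by rank-nullity both parts have
    as dimension the sum of the two ranks of [xx]. *)
Lemma sdim_exact (M : rmodule A) :
    (forall m : M, ract m xx = 0 -> exists m', m = ract m' xx) ->
  sdim (parity_idem false) (parity_idem true) M = 0.
Proof.
move=> ex; pose f : 'End(M) := linfun (ractf xx).
pose U b := espace (parity_idem b) M.
have fE x : f x = ract x xx by rewrite lfunE.
have UE b : (\dim (U b) = \dim (f @: U (~~ b)) + \dim (f @: U b))%N.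
  rewrite -(limg_ker_dim f (U b)); congr (\dim _ + _)%N.
  apply/vspaceP => x; rewrite memv_cap memv_ker fE.
  apply/andP/memv_imgP.
    move=> [/(espaceP (parity_idemP b)) xb /eqP/ex[y xy]].
    exists (ract y (parity_idem (~~ b))).
      by apply/(espaceP (parity_idemP _)); rewrite -ractM parity_idemP.
    by rewrite fE -ractM -xx_parity ractM -xy.
  move=> [y yb ->].
  rewrite fE; split; last by rewrite -ractM xx2 ractr0.
  apply/(espaceP (parity_idemP b)); rewrite -ractM xx_parity ractM.
  by move/(espaceP (parity_idemP _)): yb => ->.
by rewrite /sdim -!/(U _) !UE /= addnC subrr.
Qed.

Program Definition simple_rep (v : 'I_n) : zigzag_rep k n :=
  @ZigzagRep k n k^o (fun u x => (u == v)%:R * x) (fun=> 0) _ _ _ _ _ _ _.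
Next Obligation. by move=> v u c x y; rewrite /= mulrDr mulrCA. Qed.
Next Obligation. by move=> v c x y; rewrite scaler0 addr0. Qed.
Next Obligation. by move=> v u x; exact: delta_id. Qed.
Next Obligation. by move=> v u u' x ne; exact: delta_ne. Qed.
Next Obligation. by move=> v x; exact: delta_sum. Qed.
Next Obligation. by move=> v u u' x _; exact: mulr0. Qed.
Next Obligation. by []. Qed.

Lemma sdim_simple (v : 'I_n) :
  sdim (parity_idem false) (parity_idem true) (zmod hn (simple_rep v)) != 0.
Proof.
pose S := zmod hn (simple_rep v).
have par b (x : S) : ract x (parity_idem b) = (odd v == b)%:R * (x : k^o).
  rewrite ractr_sum; under eq_bigr do rewrite zmod_ev /=.
  rewrite big_mkcond (bigD1 v) //= big1 ?addr0; last first.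
    by move=> u /negbTE nu; rewrite nu mul0r if_same.
  by rewrite eqxx mul1r; case: eqP; rewrite ?mul1r ?mul0r.
have dimS b : \dim (espace (parity_idem b) S) = (odd v == b).
  case: eqVneq (par b) => e parb /=.
    suff -> : espace (parity_idem b) S = fullv by rewrite dimvf.
    apply/vspaceP => x; rewrite memvf; apply/(espaceP (parity_idemP b)).
    by rewrite parb mul1r.
  apply/eqP; rewrite dimv_eq0 -subv0; apply/subvP => x.
  move=> /(@espaceP _ _ _ (parity_idemP b) S); rewrite parb mul0r => <-.
  exact: mem0v.
by rewrite /sdim !dimS; case: odd.
Qed.

End Parity.

Theorem theorem5 (k : closedFieldType) (n : nat) (hn : (2 <= n)%N) :
  ~ exists (m : nat) (M : 'I_m -> rmodule (C_algebra k hn)),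
      full_exceptional_sequence M.
Proof.
move=> [m [M [[exc _] gen]]].
have tri :=
  euler_zero_tri (@parity_idemP k n hn false) (@parity_idemP k n hn true).
pose v : 'I_n := Ordinal (ltnW hn).
have /eqP := sdim_simple k hn v; apply.
(* Generation is applied to the subcategory of vanishing Euler characteristic and to the stalk of
   the simple module at vertex 0. *)
apply/euler_zero_stalk; apply: (gen _ tri) => t; apply/euler_zero_stalk.
by apply/sdim_exact/Ext2_exact; have [_ ext] := exc t; apply: ext.
Qed.
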